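(* Let $T$ be a non-star tree and let $x$ be a vertex of $T$ that is not a bad vertex of $T$. Then there exists a $(T,x)$-good 2-placement.
   Context: All graphs are finite, simple and undirected; $dist$ denotes distance in $T$ and $d(y)$ the degree of $y$ in $T$. A non-star tree is a tree not isomorphic to a star $K_{1,m}$ for any $m\ge0$. A vertex $x$ is a bad vertex of $T$ if $T$ is isomorphic to the path $P_5$ on five vertices and $x$ is its middle vertex. A permutation $\sigma$ of $V(T)$ is a 2-placement of $T$ if for every edge $ab\in E(T)$, $\sigma(a)\sigma(b)\notin E(T)$. $T^k$ is the $k$-th power of $T$; $\sigma(T)\subseteq T^k$ means that for every edge $ab$ of $T$, $dist(\sigma(a),\sigma(b))\le k$. A fixed-point-free permutation $\sigma$ of $V(T)$ is a $(T,x)$-good 2-placement if: (1) $\sigma$ is a 2-placement of $T$; (2) $\sigma(T)\subseteq T^5$; (3) $dist(x,\sigma(x))=1$; (4) $dist(y,\sigma(y))\le 2$ for every neighbor $y$ of $x$; (5) $dist(y,\sigma(y))\le 4$ for every $y$ with $d(y)=1$. *)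

(* Defs.v *)
From mathcomp Require Import all_boot all_fingroup.
Set Implicit Arguments. Unset Strict Implicit. Unset Printing Implicit Defensive.

Definition simple_graph (T : finType) (e : rel T) : Prop :=
  irreflexive e /\ symmetric e.

Definition num_edges (T : finType) (e : rel T) : nat :=
  #|[set p : T * T | e p.1 p.2]| %/ 2.

Definition is_tree (T : finType) (e : rel T) : Prop :=
  [/\ simple_graph e, 0 < #|T|, (forall a b : T, connect e a b)
    & num_edges e = #|T| - 1].

Definition is_star (T : finType) (e : rel T) : Prop :=
  exists c : T, forall a b : T, e a b -> a = c \/ b = c.

Definition dist_le (T : finType) (e : rel T) (a b : T) (k : nat) : Prop :=
  exists p : seq T, [/\ size p <= k, path e a p & last a p = b].

Definition bad_vertex (T : finType) (e : rel T) (x : T) : Prop :=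
  exists f : 'I_5 -> T,
    [/\ bijective f,
        (forall i j : 'I_5, e (f i) (f j) = ((i == j.+1 :> nat) || (j == i.+1 :> nat)))
      & x = f (inord 2)].

Definition degree (T : finType) (e : rel T) (y : T) : nat := #|[set z | e y z]|.

Definition two_placement (T : finType) (e : rel T) (s : {perm T}) : Prop :=
  forall a b : T, e a b -> ~~ e (s a) (s b).

Definition good_two_placement (T : finType) (e : rel T) (x : T) (s : {perm T}) : Prop :=
  [/\ (forall y : T, s y != y),
      two_placement e s,
      (forall a b : T, e a b -> dist_le e (s a) (s b) 5),
      e x (s x)
    & (forall y : T, e x y -> dist_le e y (s y) 2)] /\
  (forall y : T, degree e y = 1 -> dist_le e y (s y) 4).

(* Main.v *)
Require Import Defs.
From HB Require Import structures.
From mathcomp Require Import all_boot all_fingroup.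
From mathcomp Require Import zify.
Set Implicit Arguments. Unset Strict Implicit. Unset Printing Implicit Defensive.

(** Induction on the size of the tree rooted at [x].  If an edge [xy], or an edge [yz] with [y] a
    neighbour of [x], splits the tree into two parts to which induction applies (with roots [x] and
    the far end of the edge), the union of the two placements works: [x] and [y] move by at most 2
    and the far end by exactly 1, so the images of the ends of the cut edge are at distance at most 5
    and lie in different parts without being adjacent.  In the same way one can split off, at [x] or
    at a neighbour of [x], any forest that has a placement of its own keeping the top near the root:
    two branches taken among pendant paths with 1, 2 or 3 vertices, or one path with 5 vertices
    attached by its middle.  Two or more leaves can be removed at a vertex that then becomes a leaf,
    because leaves move by at most 4.  What survives these reductions is either one of finitely many
    trees, whose placements are found by evaluating a backtracking search, or the case where the only
    large part [Z] hangs from a neighbour [y] of [x] by an edge [yz] and the rest is tiny; there [y]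
    takes over the image of [z], and [z] is sent to a neighbour of [y] in the rest. *)

(** * Placements of graphs given by edge lists *)

Section ListGraph.
Variable T : eqType.
Implicit Types (V : seq T) (E : seq (T * T)) (a b x y : T) (s : T -> T).

Definition adj E a b := ((a, b) \in E) || ((b, a) \in E).

(* The vertices reached from [a] by at most [k] edges, with repetitions; recursing on balls rather
   than on walks keeps the evaluation of [near] polynomial. *)
Fixpoint ball E k a : seq T :=
  if k is k'.+1 then
    let s := ball E k' a in
    s ++ [seq p.2 | p <- E & p.1 \in s] ++ [seq p.1 | p <- E & p.2 \in s]
  else [:: a].

Definition near E k a b := b \in ball E k a.

Definition deg E v := count (fun p => (p.1 == v) || (p.2 == v)) E.

Lemma adjC E a b : adj E a b = adj E b a.
Proof. by rewrite /adj orbC. Qed.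

Lemma adj_cat E1 E2 a b : adj (E1 ++ E2) a b = adj E1 a b || adj E2 a b.
Proof. by rewrite /adj !mem_cat orbACA. Qed.

Lemma adj_sub E1 E2 a b : {subset E1 <= E2} -> adj E1 a b -> adj E2 a b.
Proof. by move=> sub /orP[] /sub h; rewrite /adj h ?orbT. Qed.

Lemma adj_perm E1 E2 : perm_eq E1 E2 -> adj E1 =2 adj E2.
Proof. by move=> h a b; rewrite /adj !(perm_mem h). Qed.

Lemma nearO E a b : near E 0 a b = (a == b).
Proof. by rewrite /near inE eq_sym. Qed.

Lemma nearS E k a b :
  reflect (near E k a b \/ exists2 c, near E k a c & adj E c b) (near E k.+1 a b).
Proof.
rewrite /near /= !mem_cat; apply: (iffP or3P) => [[h|/mapP[p]|/mapP[p]]|[h|[c h /orP[]cb]]].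
- by left.
- by rewrite mem_filter => /andP[h pE] ->; right; exists p.1; rewrite // /adj -surjective_pairing pE.
- by rewrite mem_filter => /andP[h pE] ->; right; exists p.2; rewrite // adjC /adj -surjective_pairing pE.
- exact: Or31.
- by apply: Or32; apply/mapP; exists (c, b); rewrite // mem_filter h.
- by apply: Or33; apply/mapP; exists (b, c); rewrite // mem_filter h.
Qed.

Lemma near_le E m n a b : m <= n -> near E m a b -> near E n a b.
Proof. by move=> /subnK <-; elim: (n - m) => // k IH /IH h; apply/nearS; left. Qed.

Lemma near0 E k a : near E k a a.
Proof. by apply: (near_le (leq0n k)); rewrite nearO. Qed.

Lemma near_sub E1 E2 k a b : {subset E1 <= E2} -> near E1 k a b -> near E2 k a b.
Proof.
move=> sub; elim: k b => [|k IH] b; first by rewrite !nearO.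
by case/nearS=> [/IH h|[c /IH h /(adj_sub sub) cb]]; apply/nearS; [left | right; exists c].
Qed.

Lemma near_perm E1 E2 k : perm_eq E1 E2 -> near E1 k =2 near E2 k.
Proof.
by move=> h a b; apply/idP/idP; apply: near_sub => p; rewrite (perm_mem h).
Qed.

Lemma near_trans E m n a b c : near E m a b -> near E n b c -> near E (m + n) a c.
Proof.
move=> ab; elim: n c => [|n IH] c; first by rewrite nearO addn0 => /eqP<-.
by rewrite addnS => /nearS[/IH h|[d /IH h dc]]; apply/nearS; [left | right; exists d].
Qed.

Lemma adj_near E a b : adj E a b -> near E 1 a b.
Proof. by move=> h; apply/nearS; right; exists a => //; apply: near0. Qed.

Lemma near_sym E k a b : near E k a b = near E k b a.
Proof.
have h a1 b1 : near E k a1 b1 -> near E k b1 a1; last by apply/idP/idP; apply: h.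
elim: k b1 => [|k IH] b1; first by rewrite !nearO eq_sym.
case/nearS=> [/IH h|[c /IH h cb]]; first by apply/nearS; left.
by rewrite -add1n; apply: near_trans h; apply: adj_near; rewrite adjC.
Qed.

Lemma deg_cat E1 E2 v : deg (E1 ++ E2) v = deg E1 v + deg E2 v.
Proof. exact: count_cat. Qed.

Lemma deg_perm E1 E2 : perm_eq E1 E2 -> deg E1 =1 deg E2.
Proof. by move=> /seq.permP h v; apply: h. Qed.

Definition closed_edges V E := forall p, p \in E -> p.1 \in V /\ p.2 \in V.

Lemma closed_adj V E a b : closed_edges V E -> adj E a b -> a \in V /\ b \in V.
Proof. by move=> cl /orP[] /cl[]. Qed.

(* The vertices satisfying [X] are exempt from the conditions on edges. *)
Definition placement V E (D : T -> T -> bool) (X : pred T) s :=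
  [&& perm_eq (map s V) V, all (fun v => D v (s v)) V
    & all (fun p => [|| X p.1, X p.2
            | ~~ adj E (s p.1) (s p.2) && near E 5 (s p.1) (s p.2)]) E].

(** The leaf condition reads [deg E v <= 1] rather than [= 1] so that it passes from a part to a
    larger graph, where degrees can only grow. *)
Definition good_at E x v w :=
  [&& w != v, (v == x) ==> adj E x w, adj E x v ==> near E 2 v w
    & (deg E v <= 1) ==> near E 4 v w].

Definition good V E x s := placement V E (good_at E x) pred0 s.

(** The bound 4 at every vertex, not just at leaves, makes any vertex of a searched placement
    available for gluing with [d = 4]. *)
Definition base_at E x v w := good_at E x v w && near E 4 v w.

(* A placement of a forest that will be glued at the vertex [y] of a placed graph in which [y]
   is moved by at most [d]. *)
Definition ext_at d E y v w :=
  if v == y then w == y else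
  [&& w != v, adj E y v ==> near E (5 - d) y w && near E 2 v w
    & (deg E v <= 1) ==> near E 4 v w].

Definition ext d V E y s := placement V E (ext_at d E y) (pred1 y) s.

(* Here [s y] stands for the image of a vertex [z] outside the graph, adjacent to [y], while [y]
   itself is sent to the image of [z] under a placement of the component of [z]. *)
Definition ins_at E x y v w :=
  if v == y then adj E y w else
  [&& good_at E x v w & adj E y v ==> near E 3 y w].

Definition ins V E x y s := placement V E (ins_at E x y) (pred1 y) s.

Lemma placement_mem V E D X s v : placement V E D X s -> v \in V -> s v \in V.
Proof. by case/and3P=> h _ _ vV; rewrite -(perm_mem h) map_f. Qed.

Lemma placement_at V E D X s v : placement V E D X s -> v \in V -> D v (s v).
Proof. by case/and3P=> _ /allP h _ /h. Qed.

Lemma placement_edge V E D X s a b : placement V E D X s -> ~~ X a -> ~~ X b ->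
  adj E a b -> ~~ adj E (s a) (s b) && near E 5 (s a) (s b).
Proof.
case/and3P=> _ _ /allP h /negbTE Xa /negbTE Xb /orP[] /h /=; rewrite Xa Xb //=.
by rewrite adjC near_sym.
Qed.

Lemma good_vertex V E x s v : good V E x s -> v \in V ->
  [/\ s v != v, v = x -> adj E x (s v), adj E x v -> near E 2 v (s v)
    & deg E v <= 1 -> near E 4 v (s v)].
Proof.
move=> g /(placement_at g)/and4P[n /implyP h1 /implyP h2 /implyP h3]; split=> // e.
by apply: h1; rewrite e.
Qed.

End ListGraph.

(** * Transport of placements along an injective relabelling *)

Section Relabel.
Variables (aT rT : eqType) (a0 : aT) (f : aT -> rT) (V : seq aT) (E : seq (aT * aT)).
Hypotheses (f_inj : {in V &, injective f}) (clE : closed_edges V E).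
Let fE := [seq (f p.1, f p.2) | p <- E].

Lemma adj_map a b : a \in V -> b \in V -> adj fE (f a) (f b) = adj E a b.
Proof.
have fwd u v : u \in V -> v \in V -> ((f u, f v) \in fE) = ((u, v) \in E).
  move=> uV vV; apply/mapP/idP => [[[c d] h [/f_inj e1 /f_inj e2]]|h]; last by exists (u, v).
  by case: (clE h) => cV dV; rewrite e1 // e2.
by move=> aV bV; rewrite /adj !fwd.
Qed.

Lemma near_map k a b : near E k a b -> near fE k (f a) (f b).
Proof.
elim: k b => [|k IH] b; first by rewrite nearO => /eqP->; apply: near0.
case/nearS=> [/IH h|[c /IH h cb]]; apply/nearS; [by left | right; exists (f c) => //].
by case: (closed_adj clE cb) => *; rewrite adj_map.
Qed.

Lemma deg_map a : a \in V -> deg fE (f a) = deg E a.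
Proof.
move=> aV; rewrite /deg count_map; apply: eq_in_count => p /clE[h1 h2] /=.
by rewrite !(inj_in_eq f_inj).
Qed.

Lemma good_at_map x v w : x \in V -> v \in V -> w \in V ->
  good_at E x v w -> good_at fE (f x) (f v) (f w).
Proof.
move=> xV vV wV; rewrite /good_at !(inj_in_eq f_inj) // !adj_map // deg_map //.
case/and4P=> -> -> h1 h2 /=; apply/andP; split.
  by apply/implyP=> h; apply: near_map; apply: (implyP h1).
by apply/implyP=> h; apply: near_map; apply: (implyP h2).
Qed.

Lemma base_at_map x v w : x \in V -> v \in V -> w \in V ->
  base_at E x v w -> base_at fE (f x) (f v) (f w).
Proof. by move=> xV vV wV /andP[h1 h2]; rewrite /base_at good_at_map // near_map. Qed.

Lemma ext_at_map d y v w : y \in V -> v \in V -> w \in V ->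
  ext_at d E y v w -> ext_at d fE (f y) (f v) (f w).
Proof.
move=> yV vV wV; rewrite /ext_at !(inj_in_eq f_inj) // adj_map // deg_map //.
case: ifP => // _ /and3P[-> h1 h2] /=; apply/andP; split; apply/implyP=> h.
  by case/andP: (implyP h1 h) => *; rewrite !near_map.
exact/near_map/(implyP h2).
Qed.

Lemma ins_at_map x y v w : x \in V -> y \in V -> v \in V -> w \in V ->
  ins_at E x y v w -> ins_at fE (f x) (f y) (f v) (f w).
Proof.
move=> xV yV vV wV; rewrite /ins_at (inj_in_eq f_inj) // !adj_map //.
case: ifP => // _ /andP[h1 h2]; rewrite good_at_map //=.
by apply/implyP=> h; apply: near_map; apply: (implyP h2).
Qed.

Lemma placement_map (D : aT -> aT -> bool) (D' : rT -> rT -> bool) (X : pred aT) (X' : pred rT) s :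
  {in V &, forall v w, D v w -> D' (f v) (f w)} -> {in V, forall v, X v -> X' (f v)} ->
  placement V E D X s ->
  exists s', placement (map f V) fE D' X' s' /\ {in V, forall v, s' (f v) = f (s v)}.
Proof.
move=> DD' XX' pl.
(* [g] inverts [f] on [V] by position in the list; the default [a0] is never reached at a label
   [f v] with [v] in [V]. *)
pose g z := nth a0 V (index z (map f V)).
have gK: {in V, forall v, g (f v) = v}.
  move=> v vV; have lt : index (f v) (map f V) < size V by rewrite -(size_map f) index_mem map_f.
  apply: f_inj => //; first exact: mem_nth.
  by rewrite -(nth_map _ (f a0)) // nth_index // map_f.
exists (fun z => f (s (g z))); split=> [|v vV]; last by rewrite gK.
have e: {in V, forall v, f (s (g (f v))) = f (s v)} by move=> v vV; rewrite gK.
case/and3P: (pl) => p1 p2 p3; apply/and3P; split.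
- rewrite -map_comp (eq_in_map _ (f \o s) V).1 => [|v vV /=]; last by rewrite e.
  by rewrite map_comp perm_map.
- apply/allP => _ /mapP[v vV ->]; rewrite e // DD' //; first exact: placement_mem pl vV.
  exact: (allP p2).
- apply/allP => _ /mapP[p pE ->] /=; have [h1 h2] := clE pE.
  have /or3P[h|h|/andP[h3 h4]] := allP p3 _ pE.
  + by rewrite XX'.
  + by rewrite (XX' p.2) // orbT.
  + by rewrite !e // adj_map ?h3 ?near_map ?orbT //; exact: placement_mem pl _.
Qed.

End Relabel.

(** * Gluing the placements of two parts of a tree *)

Section Merge.
Variable T : eqType.
Implicit Types (V : seq T) (E : seq (T * T)) (x y z : T) (s : T -> T).

Lemma perm_map_glue V1 V2 s1 s2 : uniq (V2 ++ V1) ->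
  perm_eq (map s1 V1) V1 -> perm_eq (map s2 V2) V2 ->
  perm_eq (map (fun v => if v \in V2 then s2 v else s1 v) (V2 ++ V1)) (V2 ++ V1).
Proof.
rewrite cat_uniq => /and3P[_ /hasPn disj _] p1 p2; rewrite map_cat; apply: perm_cat.
  by rewrite (eq_in_map _ s2 V2).1 // => v ->.
by rewrite (eq_in_map _ s1 V1).1 // => v /disj /negbTE ->.
Qed.

(** The parts share only [y], which [s2] fixes, so [s2] is used on [V2] and [s1] on [V1]. An edge
    from [y] into [V2] goes to a pair between [V1] and [V2]. Its end [s1 y] differs from [y], the
    only vertex of [V1] with neighbours in [V2], so the pair is not an edge; the route through [y]
    has length at most [d + (5 - d)]. *)
Lemma good_ext d V1 E1 x s1 V2 E2 y s2 V E : d <= 4 ->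
  closed_edges V1 E1 -> (forall p, p \in E2 -> p.1 \in rcons V2 y /\ p.2 \in V2) ->
  uniq (V2 ++ V1) -> x \in V1 -> y \in V1 ->
  good V1 E1 x s1 -> near E1 d y (s1 y) -> ext d (rcons V2 y) E2 y s2 ->
  perm_eq V (V2 ++ V1) -> perm_eq E (E2 ++ E1) ->
  exists s, good V E x s /\ {in V1, s =1 s1}.
Proof.
move=> d4 cl1 cl2 uV xV1 yV1 g1 ny g2 pV pE.
have disj v : v \in V1 -> v \in V2 = false.
  by move=> vV; move: uV; rewrite cat_uniq => /and3P[_ /hasPn h _]; apply/negbTE/h.
have yV2 := disj _ yV1.
have s2y : s2 y = y.
  have := placement_at g2 (v := y); rewrite mem_rcons mem_head => /(_ isT).
  by rewrite /ext_at eqxx => /eqP.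
have sub1 : {subset E1 <= E} by move=> p h; rewrite (perm_mem pE) mem_cat h orbT.
have sub2 : {subset E2 <= E} by move=> p h; rewrite (perm_mem pE) mem_cat h.
(* A vertex of [V2] sent to [y] would give [y] a second preimage under [s2], which already fixes
   it. *)
have s2V v : v \in V2 -> s2 v \in V2.
  move=> vV; have := placement_mem g2 (v := v); rewrite !mem_rcons !inE vV orbT => /(_ isT).
  case/orP=> // /eqP e; case/and3P: g2 => p2 _ _.
  have: uniq (map s2 (rcons V2 y)).
    rewrite (perm_uniq p2) rcons_uniq yV2; move: uV; by rewrite cat_uniq => /andP[->].
  by rewrite map_rcons rcons_uniq s2y -e map_f.
have at2 v : v \in V2 -> [&& s2 v != v, adj E2 y v ==> near E2 (5 - d) y (s2 v) && near E2 2 v (s2 v)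
    & (deg E2 v <= 1) ==> near E2 4 v (s2 v)].
  move=> vV; have := placement_at g2 (v := v); rewrite mem_rcons inE vV orbT => /(_ isT).
  by rewrite /ext_at; case: eqP vV yV2 => [-> ->|].
have adjE a b : adj E a b = adj E2 a b || adj E1 a b by rewrite (adj_perm pE) adj_cat.
have adj2 a b : a \in V1 -> adj E2 a b -> a = y /\ b \in V2.
  move=> aV /orP[] /cl2[/=]; last by rewrite (disj a aV).
  by rewrite mem_rcons inE (disj a aV) orbF => /eqP.
have adj1 a b : b \in V2 -> adj E1 a b = false.
  by move=> bV; apply/negP=> /(closed_adj cl1)[_ /disj]; rewrite bV.
pose s v := if v \in V2 then s2 v else s1 v.
have sV1 v : v \in V1 -> s v = s1 v by move=> /disj h; rewrite /s h.
have sV2 v : v \in V2 -> s v = s2 v by move=> h; rewrite /s h.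
exists s; split; last exact: sV1.
have s1V v : v \in V1 -> s1 v \in V1 by apply: placement_mem g1.
apply/and3P; split.
- apply: (perm_trans (perm_map s pV)); rewrite perm_sym.
  apply: (perm_trans pV); rewrite perm_sym.
  apply: perm_map_glue => //; first by case/and3P: g1.
  by case/and3P: g2 => + _ _; rewrite map_rcons s2y -!cats1 perm_cat2r.
- apply/allP=> v; rewrite (perm_mem pV) mem_cat => /orP[vV|vV]; rewrite /good_at.
    have nx : v != x by apply: contraL xV1 => /eqP <-; apply: contraL vV => /disj ->.
    rewrite sV2 // (negbTE nx) /= adjE (adj1 x v) // orbF.
    have /and3P[-> h1 h2] := at2 v vV; rewrite /=; apply/andP; split; apply/implyP=> h.
      have [e _] := adj2 _ _ xV1 h; rewrite e in h.
      by case/andP: (implyP h1 h) => _; apply: near_sub.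
    apply: near_sub sub2 _; apply: (implyP h2).
    by apply: leq_trans h; rewrite (deg_perm pE) deg_cat leq_addr.
  rewrite sV1 //; have /and4P[-> h1 h2 h3] := placement_at g1 vV; rewrite /=; apply/and3P; split.
  + by apply/implyP=> /(implyP h1); apply: adj_sub.
  + apply/implyP; rewrite adjE => /orP[/(adj2 _ _ xV1)[_]|]; first by rewrite disj.
    by move=> /(implyP h2); apply: near_sub.
  + apply/implyP; rewrite (deg_perm pE) deg_cat => h; apply: near_sub sub1 _; apply: (implyP h3).
    exact: leq_trans (leq_addl _ _) h.
- apply/allP=> p; rewrite (perm_mem pE) mem_cat => /orP[pE2|pE1].
    have [p1 p2] := cl2 _ pE2; have := p1; rewrite mem_rcons inE => /predU1P[e|p1V].
      rewrite /= e [s p.2]sV2 // sV1 // adjE.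
      have h : adj E2 y p.2 by rewrite /adj -e -surjective_pairing pE2.
      have /and3P[_ /implyP/(_ h)/andP[n2 _] _] := at2 _ p2.
      have -> : adj E1 (s1 y) (s2 p.2) = false by apply: adj1; apply: s2V.
      have /and4P[sy _ _ _] := placement_at g1 yV1.
      rewrite orbF; apply/andP; split.
        by apply/negP=> /(adj2 _ _ (s1V _ yV1))[/eqP]; rewrite (negbTE sy).
      have -> : 5 = d + (5 - d) by rewrite subnKC // leqW.
      apply: near_trans (near_sub sub2 n2).
      by rewrite near_sym; apply: near_sub ny.
    have h : adj E2 p.1 p.2 by rewrite /adj -surjective_pairing pE2.
    have ny1 : p.1 != y by apply: contraL p1V => /eqP->; rewrite yV2.
    have ny2 : p.2 != y by apply: contraL p2 => /eqP->; rewrite yV2.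
    have /andP[h1 h2] := placement_edge g2 ny1 ny2 h.
    by rewrite /= !sV2 // adjE (negbTE h1) adj1 ?s2V //=; apply: near_sub h2.
  have [p1 p2] := cl1 _ pE1; have h : adj E1 p.1 p.2 by rewrite /adj -surjective_pairing pE1.
  have /andP[h1 h2] := placement_edge g1 isT isT h.
  rewrite /= !sV1 // adjE (negbTE h1) orbF; apply/andP; split; last exact: near_sub h2.
  by apply/negP=> /(adj2 _ _ (s1V _ p1))[_]; rewrite disj ?s1V.
Qed.

(** The vertices [y] and [z] trade images: [s y = s' z] and [s z = pi y]. Every edge at [y] or [z]
    then goes to a pair between the two parts, and this pair is not [yz] because [pi y] is not [y]
    and [s' z] is not [z]. The distances are at most 1 + 2 for [yz], 2 + 1 + 2 for the other edges
    at [z], and 2 + 3 for the other edges at [y]. *)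
Lemma good_ins VR ER x y pi VZ EZ z s' V E :
  closed_edges VR ER -> closed_edges VZ EZ -> uniq (VZ ++ VR) ->
  irreflexive (adj ER) -> irreflexive (adj EZ) ->
  x \in VR -> y \in VR -> z \in VZ -> adj ER x y ->
  ins VR ER x y pi -> good VZ EZ z s' ->
  perm_eq V (VZ ++ VR) -> perm_eq E ((y, z) :: EZ ++ ER) ->
  exists s, good V E x s.
Proof.
move=> clR clZ uV irR irZ xR yR zZ xy gR gZ pV pE.
have disj v : v \in VR -> v \in VZ = false.
  by move=> vV; move: uV; rewrite cat_uniq => /and3P[_ /hasPn h _]; apply/negbTE/h.
have subR : {subset ER <= E} by move=> p h; rewrite (perm_mem pE) inE mem_cat h !orbT.
have subZ : {subset EZ <= E} by move=> p h; rewrite (perm_mem pE) inE mem_cat h orbT.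
have adjE a b : adj E a b = [|| (a == y) && (b == z), (a == z) && (b == y), adj EZ a b | adj ER a b].
  rewrite (adj_perm pE) -cat1s !adj_cat /adj !inE !xpair_eqE -!orbA; congr (_ || _).
  by rewrite andbC.
have nonadjZ a b : a \in VR -> adj EZ a b = false.
  by move=> /disj aR; apply/negP=> /(closed_adj clZ)[]; rewrite aR.
have nonadjR a b : b \in VZ -> adj ER a b = false.
  by move=> bZ; apply/negP=> /(closed_adj clR)[_ /disj]; rewrite bZ.
have nonadjZ' a b : b \in VR -> adj EZ a b = false by rewrite adjC; apply: nonadjZ.
have nonadjR' a b : a \in VZ -> adj ER a b = false by rewrite adjC; apply: nonadjR.
have crossing a b : a \in VR -> b \in VZ -> a != y -> adj E a b = false.
  move=> aR bZ /negbTE nay; rewrite adjE nay nonadjZ // nonadjR // /= orbF.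
  by apply/negP=> /andP[/eqP e _]; move: (disj _ aR); rewrite e zZ.
have nxy : x != y by apply: contraTN xy => /eqP->; rewrite irR.
have adjyz : adj E y z by rewrite adjE !eqxx.
have nyz : y != z by apply: contraL zZ => /eqP<-; rewrite disj.
pose s v := if v == z then pi y else if v == y then s' z else if v \in VZ then s' v else pi v.
have sz : s z = pi y by rewrite /s eqxx.
have sy : s y = s' z by rewrite /s (negbTE nyz) eqxx.
have sZ v : v \in VZ -> v != z -> s v = s' v.
  by rewrite /s => h /negbTE->; rewrite h; case: eqP h => // ->; rewrite disj.
have sR v : v \in VR -> v != y -> s v = pi v.
  by rewrite /s => h /negbTE->; rewrite disj //; case: eqP h zZ => // -> /disj->.
have piR v : v \in VR -> pi v \in VR by apply: placement_mem gR.
have s'Z v : v \in VZ -> s' v \in VZ by apply: placement_mem gZ.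
have ypy : adj ER y (pi y) by have := placement_at gR yR; rewrite /ins_at eqxx.
have npy : pi y != y by apply: contraTN ypy => /eqP->; rewrite irR.
have /and4P[s'z zs' nbz _] := placement_at gZ zZ; rewrite eqxx /= in zs'.
have near_y_s'z : near E 2 y (s' z).
  apply: (near_trans (m := 1) (n := 1) (b := z)); apply: adj_near => //; exact: adj_sub zs'.
have near_z_piy : near E 2 z (pi y).
  apply: (near_trans (m := 1) (n := 1) (b := y)); apply: adj_near; first by rewrite adjC.
  exact: adj_sub ypy.
exists s; apply/and3P; split.
- apply: (perm_trans (perm_map s pV)); rewrite perm_sym.
  apply: (perm_trans pV); rewrite perm_sym.
  have uZ : uniq VZ by move: uV; rewrite cat_uniq => /andP[].
  have uR : uniq VR by move: uV; rewrite cat_uniq => /and3P[].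
  case/and3P: gZ => pZ _ _; case/and3P: gR => pR _ _.
  have eZ := perm_to_rem zZ; have eR := perm_to_rem yR.
  apply: (perm_trans (perm_map s (perm_cat eZ eR))).
  (* Up to exchanging the two values [s' z] and [pi y], the images are those of [s'] and [pi]. *)
  have pZR : perm_eq (map s' (z :: rem z VZ) ++ map pi (y :: rem y VR)) (VZ ++ VR).
    apply: perm_cat; first by apply: (perm_trans _ pZ); apply: perm_map; rewrite perm_sym.
    by apply: (perm_trans _ pR); apply: perm_map; rewrite perm_sym.
  apply: perm_trans pZR.
  rewrite map_cat /= sz sy.
  have -> : map s (rem z VZ) = map s' (rem z VZ).
    by apply/eq_in_map=> v; rewrite mem_rem_uniq // inE => /andP[? ?]; apply: sZ.
  have -> : map s (rem y VR) = map pi (rem y VR).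
    by apply/eq_in_map=> v; rewrite mem_rem_uniq // inE => /andP[? ?]; apply: sR.
  by apply/seq.permP=> q; rewrite /= !count_cat /=; clear; lia.
- apply/allP=> v; rewrite (perm_mem pV) mem_cat => /orP[vV|vV]; rewrite /good_at.
    have nx : v != x by apply: contraL xR => /eqP <-; apply: contraL vV => /disj ->.
    rewrite (negbTE nx) /=; have [->|nvz] := eqVneq v z.
      rewrite sz (contraL _ zZ) => [|/eqP <-]; last by rewrite disj ?piR.
      by rewrite near_z_piy (near_le _ near_z_piy) // !implybT.
    have /and4P[n _ _ h] := placement_at gZ vV; rewrite sZ // n adjE (negbTE nvz) andbF /=.
    have -> : x == z = false by apply: contraTF zZ => /eqP<-; rewrite disj.
    rewrite nonadjZ ?nonadjR //=; apply/implyP=> dv; apply: near_sub subZ _; apply: (implyP h).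
    by apply: leq_trans dv; rewrite (deg_perm pE) -cat1s !deg_cat addnCA leq_addr.
  have [->|nvy] := eqVneq v y.
    rewrite sy (eq_sym y x) (negbTE nxy) near_y_s'z (near_le _ near_y_s'z) // !implybT !andbT /=.
    by apply: contraL yR => /eqP<-; apply: contraL (s'Z _ zZ) => /disj->.
  have := placement_at gR vV; rewrite /ins_at (negbTE nvy) => /andP[/and4P[n h1 h2 h3] _].
  rewrite sR // n /=; apply/and3P; split.
  + by apply/implyP=> /(implyP h1); apply: adj_sub.
  + apply/implyP; rewrite adjE (negbTE nxy) (negbTE nvy) andbF nonadjZ //= => /(implyP h2).
    exact: near_sub.
  + apply/implyP=> dv; apply: near_sub subR _; apply: (implyP h3).
    by apply: leq_trans dv; rewrite (deg_perm pE) -cat1s !deg_cat addnA leq_addl.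
- pose C a b := ~~ adj E (s a) (s b) && near E 5 (s a) (s b).
  have Csym a b : C a b = C b a by rewrite /C adjC near_sym.
  suff CE : forall a b, adj E a b -> C a b.
    by apply/allP=> p pp /=; apply: CE; rewrite /adj -surjective_pairing pp.
  have Cyz : C y z.
    rewrite /C sy sz; apply/andP; split; first by rewrite adjC crossing ?s'Z ?piR.
    apply: (near_le (m := 3)) => //; apply: (near_trans (m := 1) (n := 2) (b := z)) => //.
    by rewrite near_sym; apply: adj_near; apply: adj_sub zs'.
  have Cz b : adj EZ z b -> C z b.
    move=> zb; have [_ bV] := closed_adj clZ zb.
    have nbz' : b != z by apply: contraTN zb => /eqP->; rewrite irZ.
    rewrite /C sz sZ // crossing ?s'Z ?piR //=.
    apply: (near_trans (m := 2) (n := 3) (b := z)); first by rewrite near_sym.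
    apply: (near_trans (m := 1) (n := 2) (b := b)); first exact/adj_near/(adj_sub subZ).
    have /and4P[_ _ h _] := placement_at gZ bV.
    exact: near_sub subZ (implyP h zb).
  have Cy b : adj ER y b -> C y b.
    move=> yb; have [_ bV] := closed_adj clR yb.
    have nby : b != y by apply: contraTN yb => /eqP->; rewrite irR.
    rewrite /C sy sR // adjE (negbTE s'z) nonadjZ' ?piR // nonadjR' ?s'Z // !orbF.
    have -> /= : s' z == y = false by apply: contraTF yR => /eqP<-; apply: contraTN (s'Z _ zZ) => /disj->.
    apply: (near_trans (m := 2) (n := 3) (b := y)); first by rewrite near_sym.
    have := placement_at gR bV; rewrite /ins_at (negbTE nby) => /andP[_ h].
    exact: near_sub subR (implyP h yb).
  move=> a b; rewrite adjE => /or4P[/andP[/eqP-> /eqP->]|/andP[/eqP-> /eqP->]|ab|ab] //.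
  + by rewrite Csym.
  + have [az|na] := eqVneq a z; first by move: ab; rewrite az; apply: Cz.
    have [bz|nb] := eqVneq b z; first by move: ab; rewrite bz Csym adjC; apply: Cz.
    have [aV bV] := closed_adj clZ ab.
    have /andP[h1 h2] := placement_edge gZ isT isT ab.
    rewrite /C !sZ // (near_sub subZ h2) andbT adjE (negbTE h1) nonadjR ?s'Z //= orbF.
    apply/negP=> /orP[]/andP[/eqP e1 /eqP e2].
      by move: (s'Z _ aV); rewrite e1 disj.
    by move: (s'Z _ bV); rewrite e2 disj.
  + have [ay|na] := eqVneq a y; first by move: ab; rewrite ay; apply: Cy.
    have [bY|nb] := eqVneq b y; first by move: ab; rewrite bY Csym adjC; apply: Cy.
    have [aV bV] := closed_adj clR ab.
    have /andP[h1 h2] := placement_edge gR na nb ab.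
    rewrite /C !sR // (near_sub subR h2) andbT adjE (negbTE h1) nonadjZ ?piR //= orbF.
    apply/negP=> /orP[]/andP[/eqP e1 /eqP e2].
      by move: (disj _ (piR _ bV)); rewrite e2 zZ.
    by move: (disj _ (piR _ aV)); rewrite e1 zZ.
Qed.

End Merge.

(** * Labelled rooted trees and their shapes *)

(* [Add c t] is the rooted tree [t] with [c] hung below its root as an additional first branch. *)
Inductive tree (T : Type) := One of T | Add of tree T & tree T.

Inductive rshape := Pt | Br of rshape & rshape.

Fixpoint sgraft W Y := match W with Pt => Y | Br c W' => Br c (sgraft W' Y) end.
(** A context with a hole: [W] sits at the end of a path of first branches starting at the root, and
    [Ks] lists, from the root down, what else hangs at the vertices of that path above [W]. *)
Definition sfill Ks W := foldr (fun k w => Br w k) W Ks.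

Section Trees.
Variable T : eqType.
Implicit Types (t c w y k : tree T) (ks : seq (tree T)).

Fixpoint root t := match t with One x => x | Add _ t' => root t' end.
Fixpoint verts t := match t with One x => [:: x] | Add c t' => verts c ++ verts t' end.
Fixpoint below t := match t with One x => [::] | Add c t' => verts c ++ below t' end.
Fixpoint edges t :=
  match t with One _ => [::] | Add c t' => (root t', root c) :: edges c ++ edges t' end.
Fixpoint shape_of t := match t with One _ => Pt | Add c t' => Br (shape_of c) (shape_of t') end.

(** The root label of [w] is dropped: this is meant for trees with a common root, which they share
    after gluing. *)
Fixpoint graft w t := match w with One _ => t | Add c w' => Add c (graft w' t) end.
Fixpoint fill ks t := if ks is k :: ks' then Add (fill ks' t) k else t.

Lemma verts_below t : verts t = rcons (below t) (root t).
Proof. by elim: t => //= c _ t ->; rewrite rcons_cat. Qed.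

Lemma root_verts t : root t \in verts t.
Proof. by rewrite verts_below mem_rcons mem_head. Qed.

(** Edges point away from the root, which is why the second end can be located in [below t]; gluing
    at the root relies on this sharper form. *)
Lemma edges_verts t p : p \in edges t -> p.1 \in verts t /\ p.2 \in below t.
Proof.
elim: t => //= c IHc t IHt; rewrite inE (mem_cat p) => /or3P[/eqP->|/IHc[h1 h2]|/IHt[h1 h2]] /=.
- by rewrite !mem_cat !root_verts orbT.
- by rewrite !mem_cat h1 (verts_below c) mem_rcons inE h2 orbT.
- by rewrite !mem_cat h1 h2 !orbT.
Qed.

Lemma edges_closed t : closed_edges (verts t) (edges t).
Proof. by move=> p /edges_verts[-> h]; rewrite verts_below mem_rcons inE h orbT. Qed.

Lemma edges_irr t : uniq (verts t) -> irreflexive (adj (edges t)).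
Proof.
move=> u v; rewrite /adj orbb; elim: t u => //= c IHc t IHt.
rewrite cat_uniq inE mem_cat => /and3P[/IHc-> /hasPn disj /IHt->]; rewrite !orbF.
apply/eqP=> -[e1 e2]; have := disj _ (root_verts t).
by rewrite -e1 e2 root_verts.
Qed.

Lemma deg_out t v : v \notin verts t -> deg (edges t) v = 0.
Proof.
move=> nv; apply/eqP; rewrite /deg -leqn0 leqNgt -has_count; apply/hasPn=> p /edges_closed[h1 h2].
by apply/norP; split; apply: contraNneq nv => <-.
Qed.

Lemma shape_graft t W Y : shape_of t = sgraft W Y ->
  exists w y, [/\ t = graft w y, root w = root y, shape_of w = W & shape_of y = Y].
Proof.
elim: W t => [|c _ W IH] t /=; first by exists (One (root t)), t.
case: t => //= c' t [<- /IH[w [y [-> ew <- <-]]]].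
by exists (Add c' w), y.
Qed.

Lemma shape_fill t Ks W : shape_of t = sfill Ks W ->
  exists ks w, [/\ t = fill ks w, map shape_of ks = Ks & shape_of w = W].
Proof.
elim: Ks t => [|K Ks IH] t /=; first by exists [::], t.
by case: t => //= t k [/IH[ks [w [-> <- <-]]] <-]; exists (k :: ks), w.
Qed.

Lemma root_graft w y : root w = root y -> root (graft w y) = root y.
Proof. by elim: w => //= c _ w IH /IH. Qed.

Lemma verts_graft w y : verts (graft w y) = below w ++ verts y.
Proof. by elim: w => //= c _ w ->; rewrite catA. Qed.

Lemma edges_graft w y : root w = root y -> edges (graft w y) = edges w ++ edges y.
Proof. by elim: w => //= c _ w IH e; rewrite IH // root_graft // e catA. Qed.

Lemma root_fill ks t t' : root t = root t' -> root (fill ks t) = root (fill ks t').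
Proof. by case: ks. Qed.

Lemma verts_fill ks t : verts (fill ks t) = verts t ++ flatten (map verts (rev ks)).
Proof.
elim: ks => [|k ks IH] /=; first by rewrite cats0.
by rewrite rev_cons map_rcons flatten_rcons IH catA.
Qed.

Lemma verts_fill_graft ks w y :
  verts (fill ks (graft w y)) = below w ++ verts (fill ks y).
Proof. by rewrite !verts_fill verts_graft catA. Qed.

Lemma edges_fill_graft ks w y : root w = root y ->
  perm_eq (edges (fill ks (graft w y))) (edges w ++ edges (fill ks y)).
Proof.
move=> e; elim: ks => [|k ks IH] /=; first by rewrite edges_graft.
rewrite (root_fill _ (root_graft e)); apply/seq.permP=> q; move/seq.permP/(_ q): IH.
by rewrite /= !count_cat /= !count_cat; clear; lia.
Qed.

(** Nothing hangs below [u], so its only possible edge is the one going up. The displacement bound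
    for leaves then allows gluing at [u] with [d = 4]. *)
Lemma deg_fill ks u : uniq (verts (fill ks (One u))) -> deg (edges (fill ks (One u))) u <= 1.
Proof.
elim: ks => //= k ks IH; rewrite cat_uniq => /and3P[uks /hasPn disj _].
have uf : u \in verts (fill ks (One u)) by rewrite verts_fill mem_head.
have uk : u \notin verts k by apply: contraL uf => /disj.
rewrite /deg /= count_cat -!/(deg _ _) (deg_out uk) addn0.
have -> : root k == u = false by apply: contraNF uk => /eqP<-; apply: root_verts.
move/(_ uks): IH; case: ks uks {disj uf} => [|k' ks] /=; first by rewrite eqxx.
rewrite cat_uniq => /and3P[_ /hasPn disj _].
move=> IH; have e : root k' == u = false; last by rewrite e in IH *.
apply/eqP=> e; have := disj _ (root_verts k').
by rewrite e verts_fill mem_head.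
Qed.

Lemma good_fill d ks w y s1 s2 : d <= 4 -> root w = root y ->
  uniq (verts (fill ks (graft w y))) ->
  good (verts (fill ks y)) (edges (fill ks y)) (root (fill ks y)) s1 ->
  near (edges (fill ks y)) d (root y) (s1 (root y)) ->
  ext d (verts w) (edges w) (root w) s2 ->
  exists s, good (verts (fill ks (graft w y))) (edges (fill ks (graft w y)))
              (root (fill ks (graft w y))) s /\ {in verts (fill ks y), s =1 s1}.
Proof.
move=> d4 e u g1 n1 g2.
have -> : root (fill ks (graft w y)) = root (fill ks y) by apply/root_fill/root_graft.
rewrite verts_fill_graft in u *; rewrite e verts_below e in g2.
apply: good_ext d4 _ _ u _ _ g1 n1 g2 _ (edges_fill_graft ks e) => //; try exact: root_verts.
- exact: edges_closed.
- by move=> p /edges_verts[]; rewrite verts_below e.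
- by rewrite verts_fill mem_cat root_verts.
Qed.

End Trees.

Fixpoint map_tree (T U : Type) (f : T -> U) (t : tree T) : tree U :=
  match t with One x => One (f x) | Add c t' => Add (map_tree f c) (map_tree f t') end.

Section MapTree.
Variables (T U : eqType) (f : T -> U).

Lemma root_map t : root (map_tree f t) = f (root t).
Proof. by elim: t. Qed.

Lemma verts_map t : verts (map_tree f t) = map f (verts t).
Proof. by elim: t => //= c -> t ->; rewrite map_cat. Qed.

Lemma edges_map t : edges (map_tree f t) = [seq (f p.1, f p.2) | p <- edges t].
Proof. by elim: t => //= c -> t ->; rewrite map_cat !root_map. Qed.

End MapTree.

Fixpoint ssize sh := match sh with Pt => 1 | Br c t => ssize c + ssize t end.

(** Numbers follow the order of [verts], so the vertex list is an interval and every parent gets a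
    larger number than its children. *)
Fixpoint lab n sh :=
  match sh with Pt => One n | Br c t => Add (lab n c) (lab (n + ssize c) t) end.

Lemma size_verts (T : eqType) (t : tree T) : size (verts t) = ssize (shape_of t).
Proof. by elim: t => //= c <- t <-; rewrite size_cat. Qed.

Lemma verts_lab n sh : verts (lab n sh) = iota n (ssize sh).
Proof. by elim: sh n => //= c IHc t IHt n; rewrite IHc IHt iotaD. Qed.

Lemma map_lab (T : eqType) (t : tree T) x0 n (f : nat -> T) :
  (forall i, i < size (verts t) -> f (n + i) = nth x0 (verts t) i) ->
  map_tree f (lab n (shape_of t)) = t.
Proof.
elim: t n => [x|c IHc t IHt] n /= h; first by have := h 0 isT; rewrite addn0 /= => ->.
congr Add.
  by apply: IHc => i lt; rewrite h ?size_cat ?ltn_addr // nth_cat lt.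
apply: IHt => i lt; rewrite -addnA -size_verts h ?size_cat ?ltn_add2l //.
by rewrite nth_cat ltnNge leq_addr addKn.
Qed.

Lemma labP (T : eqType) (t : tree T) : uniq (verts t) ->
  exists2 f : nat -> T, {in verts (lab 0 (shape_of t)) &, injective f} &
    t = map_tree f (lab 0 (shape_of t)).
Proof.
move=> u; exists (nth (root t) (verts t)); last by rewrite (map_lab (x0 := root t)).
move=> i j; rewrite verts_lab !mem_iota -size_verts /= !add0n => lti ltj /eqP.
by rewrite nth_uniq // => /eqP.
Qed.

(** Quantifying over all label types makes this a property of the shape alone, so that the induction
    can run on shapes. *)
Definition Good sh := forall (T : eqType) (t : tree T), uniq (verts t) -> shape_of t = sh ->
  exists s, good (verts t) (edges t) (root t) s.

Definition Good4 sh := forall (T : eqType) (t : tree T), uniq (verts t) -> shape_of t = sh ->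
  exists s, placement (verts t) (edges t) (base_at (edges t) (root t)) pred0 s.

Definition Ext d W := forall (T : eqType) (w : tree T), uniq (verts w) -> shape_of w = W ->
  exists s, ext d (verts w) (edges w) (root w) s.

Definition Ins Y K := forall (T : eqType) (y k : tree T), uniq (verts (Add y k)) ->
  shape_of y = Y -> shape_of k = K ->
  exists s, ins (verts (Add y k)) (edges (Add y k)) (root k) (root y) s.

(** The bound [d] at the root of [Y] is what [Ext d] requires of a gluing vertex; it survives the
    gluing, so that several pieces can be attached there in turn. *)
Definition PGood d Ks Y := forall (T : eqType) ks (y : tree T), uniq (verts (fill ks y)) ->
  map (@shape_of T) ks = Ks -> shape_of y = Y ->
  exists s, good (verts (fill ks y)) (edges (fill ks y)) (root (fill ks y)) s
    /\ near (edges (fill ks y)) d (root y) (s (root y)).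

Lemma shape_of_fill (T : eqType) ks (y : tree T) :
  shape_of (fill ks y) = sfill (map (@shape_of T) ks) (shape_of y).
Proof. by elim: ks => //= k ks ->. Qed.

Lemma PGood_graft d Ks W Y : d <= 4 -> Ext d W -> PGood d Ks Y -> PGood d Ks (sgraft W Y).
Proof.
move=> d4 extW pg T ks t u eK /shape_graft[w [y [et ew eW eY]]]; rewrite {t}et in u *.
have u1 : uniq (verts (fill ks y)).
  by move: u; rewrite verts_fill_graft cat_uniq => /and3P[].
have uw : uniq (verts w).
  rewrite verts_below ew rcons_uniq; move: u.
  rewrite verts_fill_graft cat_uniq => /and3P[-> /hasPn h _]; rewrite andbT.
  by apply: h; rewrite verts_fill mem_cat root_verts.
have [s1 [g1 n1]] := pg T ks y u1 eK eY; have [s2 g2] := extW T w uw eW.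
have [s [g e]] := good_fill d4 ew u g1 n1 g2.
exists s; split=> //; rewrite root_graft // e; last by rewrite verts_fill mem_cat root_verts.
apply: near_sub n1 => p pE; rewrite (perm_mem (edges_fill_graft ks ew)) mem_cat.
by rewrite pE orbT.
Qed.

Lemma PGood_Good d Ks Y : PGood d Ks Y -> Good (sfill Ks Y).
Proof.
move=> pg T t u /shape_fill[ks [y [et eK eY]]]; rewrite {t}et in u *.
by have [s [g _]] := pg T ks y u eK eY; exists s.
Qed.

(** The root moves by exactly 1. The bound is weakened to 2 so that the same extensions [Ext 2]
    serve at the root and at its neighbours. *)
Lemma Good_PGood0 Y : Good Y -> PGood 2 [::] Y.
Proof.
move=> g T [|//] y u _ eY; have [s gs] := g T y u eY; exists s; split=> //=.
have [_ /(_ erefl) h _ _] := good_vertex gs (root_verts y).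
by apply: (near_le (m := 1)) => //; apply: adj_near.
Qed.

Lemma Good_PGood1 Y K : Good (Br Y K) -> PGood 2 [:: K] Y.
Proof.
move=> g T [|k []] y //= u [eK] eY; have [|s gs] := g T (Add y k) u; first by rewrite /= eK eY.
exists s; split=> //=.
have [|_ _ h _] := good_vertex gs (v := root y); first by rewrite /= mem_cat root_verts.
by apply: h; rewrite /adj /= mem_head.
Qed.

Lemma Good_PGood4 Ks : Good (sfill Ks Pt) -> PGood 4 Ks Pt.
Proof.
move=> g T ks y u eK eY; have [|s gs] := g T (fill ks y) u; first by rewrite shape_of_fill eK eY.
exists s; split=> //; have [|_ _ _ h] := good_vertex gs (v := root y).
  by rewrite verts_fill mem_cat root_verts.
by apply: h; case: y eY u {gs} => // x _ u; apply: deg_fill.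
Qed.

Lemma Good4_Good sh : Good4 sh -> Good sh.
Proof.
move=> g T t u e; have [s /and3P[p1 p2 p3]] := g T t u e; exists s; apply/and3P; split=> //.
by apply/allP=> v /(allP p2)/andP[].
Qed.

Lemma Good4_PGood Ks Y : Good4 (sfill Ks Y) -> PGood 4 Ks Y.
Proof.
move=> g T ks y u eK eY; have [|s gs] := g T (fill ks y) u; first by rewrite shape_of_fill eK eY.
exists s; split.
  case/and3P: gs => p1 p2 p3; apply/and3P; split=> //.
  by apply/allP=> v /(allP p2)/andP[].
by have /andP[] := placement_at gs (v := root y) ltac:(by rewrite verts_fill mem_cat root_verts).
Qed.

(** The edge from the fixed vertex [y] to the top of [Z] is cut. The image of that top vertex is one
    of its neighbours, hence at distance at most 2 from [y], within the allowed 5 - 2. *)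
Lemma Ext_Good Z : Good Z -> Ext 2 (Br Z Pt).
Proof.
move=> g T [//|z [|//]] y u [eZ].
have uz : uniq (verts z) by move: u; rewrite /= cat_uniq => /and3P[].
have [s gs] := g T z uz eZ; pose s' v := if v == y then y else s v.
have yz : y \notin verts z.
  by move: u; rewrite /= cat_uniq => /and3P[_ /hasPn h _]; apply: h; rewrite inE.
have s'E v : v \in verts z -> s' v = s v.
  by rewrite /s'; case: eqP => // -> /(negP yz).
have e1 : edges (Add z (One y)) = (y, root z) :: edges z by rewrite /= cats0.
have sub : {subset edges z <= edges (Add z (One y))} by move=> p h; rewrite e1 inE h orbT.
have adjy a b : b \in verts z -> adj (edges (Add z (One y))) a b =
    (a == y) && (b == root z) || adj (edges z) a b.
  move=> bz; rewrite e1 -cat1s adj_cat /adj !inE !xpair_eqE; congr (_ || _).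
  by case: (b =P y) => [e|_]; rewrite ?andbF ?orbF //; move: yz; rewrite -e bz.
exists s'; apply/and3P; split.
- rewrite /= map_cat /= /s' eqxx perm_cat2r; case/and3P: gs => p _ _.
  by apply: (perm_trans _ p); rewrite (eq_in_map s' s _).1.
- apply/allP=> v; rewrite /= mem_cat inE /ext_at => /orP[vz|/eqP->]; last by rewrite /s' !eqxx.
  have -> : v == y = false by apply: contraNF yz => /eqP<-.
  have [n h1 h2 h3] := good_vertex gs vz.
  rewrite -/(edges (Add z (One y))) s'E // n adjy //= eqxx /=; apply/andP; split; apply/implyP.
    have -> : adj (edges z) y v = false by apply/negP=> /(closed_adj (@edges_closed _ z))[/(negP yz)].
    rewrite orbF => /eqP ez; rewrite ez in h1 *; have /adj_near/(near_sub sub) h := h1 erefl.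
    rewrite (near_le _ h) // andbT; apply: (near_le (m := 2)) => //.
    apply: (near_trans (m := 1) (n := 1) _ h); apply: adj_near.
    by rewrite adjy ?root_verts // !eqxx.
  move=> d; apply: near_sub sub (h3 _); apply: leq_trans d; rewrite cats0.
  exact: leq_addl.
- apply/allP=> p; rewrite e1 inE => /predU1P[->|pE]; first by rewrite /= eqxx.
  have [p1 p2] := edges_closed pE.
  have pz : adj (edges z) p.1 p.2 by rewrite /adj -surjective_pairing pE.
  have /andP[h1 h2] := placement_edge gs isT isT pz.
  have [s1 s2] := (placement_mem gs p1, placement_mem gs p2).
  rewrite -e1 !s'E // adjy // (negbTE h1) (near_sub sub h2) /= orbF.
  by have -> : s p.1 == y = false; [apply: contraNF yz => /eqP<- | rewrite /= !orbT].
Qed.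

(** Here [x] is the root of [k], [y] its first child with remaining branches in [Y], and [Z] hangs
    below [y]. *)
Lemma Good_ins Y K Z : Ins Y K -> Good Z -> Good (Br (Br Z Y) K).
Proof.
move=> ins_YK gZ T [//|[//|z y] k] u /= [eZ eY eK].
have pV : perm_eq (verts (Add (Add z y) k)) (verts z ++ verts (Add y k)) by rewrite /= catA.
have : uniq (verts z ++ verts (Add y k)) by rewrite -(perm_uniq pV).
move=> u'; have := u'; rewrite cat_uniq => /and3P[uz _ uyk].
have [s1 h1] := ins_YK T y k uyk eY eK; have [s2 h2] := gZ T z uz eZ.
apply: (good_ins _ _ u' _ _ _ _ _ _ h1 h2 pV).
- exact: edges_closed.
- exact: edges_closed.
- exact: edges_irr.
- exact: edges_irr.
- by rewrite /= mem_cat root_verts orbT.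
- by rewrite /= mem_cat root_verts.
- exact: root_verts.
- by rewrite /adj /= mem_head.
- by apply/seq.permP=> q; rewrite /= !count_cat /= !count_cat /=; clear; lia.
Qed.

(** * Backtracking search for placements of fixed shapes *)

Section Search.
Variables (n : nat) (E : seq (nat * nat)) (D : nat -> nat -> bool) (X : pred nat).

(** At this moment the vertices from [v] on have images, hence the offsets [- v]; the edges to test
    are those whose smaller end is the newcomer [v]. *)
Definition compatible v (p : seq nat) :=
  all (fun e => [|| X e.1, X e.2, minn e.1 e.2 != v |
         let a := nth 0 p (e.1 - v) in let b := nth 0 p (e.2 - v) in
         ~~ adj E a b && near E 5 a b]) E.

(* [p] lists the images of the vertices [k], [k + 1], ..., [n - 1]. *)
Fixpoint extend k (p : seq nat) : seq nat :=
  if k is k'.+1 then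
    (fix try ws := if ws is w :: ws' then
       if w \in p then try ws' else
       if ~~ D k' w then try ws' else
       if ~~ compatible k' (w :: p) then try ws' else
       let q := extend k' (w :: p) in if nilp q then try ws' else q
     else [::]) (iota 0 n)
  else p.

Definition search := extend n [::].
(** Soundness rests on this final test alone: whatever list [extend] returns is checked in full. *)
Definition found := placement (iota 0 n) E D X (nth 0 search).
End Search.

Section Found.
Variables (T : eqType) (t : tree T).
Hypothesis u : uniq (verts t).
Let t0 := lab 0 (shape_of t).

Lemma found_placement (D0 : nat -> nat -> bool) (D : T -> T -> bool) (X0 : pred nat) (X : pred T) :
  (forall f, {in verts t0 &, injective f} -> t = map_tree f t0 ->
     {in verts t0 &, forall v w, D0 v w -> D (f v) (f w)} /\ {in verts t0, forall v, X0 v -> X (f v)}) ->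
  found (ssize (shape_of t)) (edges t0) D0 X0 ->
  exists s, placement (verts t) (edges t) D X s.
Proof.
move=> h fnd; have [f finj et] := labP u; have [hD hX] := h f finj et.
rewrite /found -verts_lab in fnd.
have [s [pl _]] := placement_map 0 finj (@edges_closed _ t0) hD hX fnd.
by exists s; rewrite et verts_map edges_map.
Qed.

End Found.

Definition found_good sh :=
  let t := lab 0 sh in found (ssize sh) (edges t) (base_at (edges t) (root t)) pred0.

Lemma Good4_found sh : found_good sh -> Good4 sh.
Proof.
move=> fnd T t u e; move: fnd; rewrite -e; apply: found_placement => // f finj et.
have eE := etrans (congr1 (@edges T) et) (edges_map _ _).
have eR := etrans (congr1 (@root T) et) (root_map _ _).
split=> // v w vV wV; rewrite eE eR.
by apply: (base_at_map finj) => //; [exact: edges_closed | exact: root_verts].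
Qed.

Definition found_ext d sh :=
  let t := lab 0 sh in found (ssize sh) (edges t) (ext_at d (edges t) (root t)) (pred1 (root t)).

Lemma Ext_found d sh : found_ext d sh -> Ext d sh.
Proof.
move=> fnd T t u e; move: fnd; rewrite -e; apply: found_placement => // f finj et.
have eE := etrans (congr1 (@edges T) et) (edges_map _ _).
have eR := etrans (congr1 (@root T) et) (root_map _ _).
split=> [v w vV wV|v _ /eqP->]; last by rewrite /= eR.
rewrite eE eR.
by apply: (ext_at_map finj) => //; [exact: edges_closed | exact: root_verts].
Qed.

Definition found_ins Y K :=
  let t := lab 0 (Br Y K) in let y := root (lab 0 Y) in
  found (ssize (Br Y K)) (edges t) (ins_at (edges t) (root t) y) (pred1 y).

Lemma Ins_found Y K : found_ins Y K -> Ins Y K.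
Proof.
move=> fnd T y k u eY eK; move: fnd; rewrite -eY -eK => fnd.
apply: (found_placement (t := Add y k)) fnd => // f finj et.
have eE := etrans (congr1 (@edges T) et) (edges_map _ _).
have [ey ek] : y = map_tree f (lab 0 (shape_of y)) /\
    k = map_tree f (lab (0 + ssize (shape_of y)) (shape_of k)) by case: et.
have eY' := etrans (congr1 (@root T) ey) (root_map _ _).
have eK' := etrans (congr1 (@root T) ek) (root_map _ _).
split=> [v w vV wV|v _ /eqP->]; last by rewrite /= eY'.
rewrite eE eY' eK'; apply: (ins_at_map finj) => //; first exact: edges_closed.
  by rewrite /= mem_cat root_verts orbT.
by rewrite /= mem_cat root_verts.
Qed.

(** * Independence of the order of branches *)

Inductive reorder : rshape -> rshape -> Prop :=
| reorder_refl t : reorder t t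
| reorder_swap c d t : reorder (Br c (Br d t)) (Br d (Br c t))
| reorder_br c c' t t' : reorder c c' -> reorder t t' -> reorder (Br c t) (Br c' t')
| reorder_trans t1 t2 t3 : reorder t1 t2 -> reorder t2 t3 -> reorder t1 t3.

(** Exchanging siblings anywhere only permutes the lists of vertices and edges. A tree of shape
    [sh'] is thus read as one of shape [sh], to which [Good sh] applies. *)
Lemma reorder_tree sh sh' : reorder sh sh' -> forall (T : eqType) (t : tree T), shape_of t = sh' ->
  exists t', [/\ shape_of t' = sh, root t' = root t, perm_eq (verts t) (verts t')
    & perm_eq (edges t) (edges t')].
Proof.
elim=> {sh sh'} [sh|c d sh|c c' t t' _ IHc _ IHt|t1 t2 t3 _ IH1 _ IH2] T t0.
- by exists t0.
- case: t0 => [//|d0 [//|c0 t0]] /= [<- <- <-]; exists (Add c0 (Add d0 t0)); split=> //=.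
    by rewrite perm_catCA.
  by apply/seq.permP=> q; rewrite /= !count_cat /= !count_cat; clear; lia.
- case: t0 => [//|c0 t0] /= [/IHc[c1 [<- rc vc ec]] /IHt[t1 [<- rt vt et]]].
  exists (Add c1 t1); split=> //=; first exact: perm_cat.
  by rewrite rc rt perm_cons perm_cat.
- case/IH2=> t2' [/IH1[t1' [<- r1 v1 e1]] r2 v2 e2].
  exists t1'; split=> //; [by rewrite r1|exact: perm_trans v2 v1|exact: perm_trans e2 e1].
Qed.

Lemma good_perm (T : eqType) (V V' : seq T) E E' x s :
  perm_eq V V' -> perm_eq E E' -> good V' E' x s -> good V E x s.
Proof.
move=> pV pE /and3P[p1 p2 p3]; apply/and3P; split.
- apply: (perm_trans (perm_map s pV)); apply: (perm_trans p1); by rewrite perm_sym.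
- rewrite (perm_all _ pV); apply: sub_all p2 => v.
  by rewrite /good_at !(adj_perm pE) !(near_perm _ pE) (deg_perm pE).
- rewrite (perm_all _ pE); apply: sub_all p3 => p.
  by rewrite !(adj_perm pE) !(near_perm _ pE).
Qed.

Lemma Good_reorder sh sh' : reorder sh sh' -> Good sh -> Good sh'.
Proof.
move=> r g T t u e; have [t' [e' rt vt et]] := reorder_tree r e.
have [|s gs] := g T t' _ e'; first by rewrite -(perm_uniq vt).
by exists s; rewrite -rt; apply: good_perm vt et gs.
Qed.

(** * Induction on shapes *)

Fixpoint shape_eqb s t :=
  match s, t with
  | Pt, Pt => true
  | Br c s', Br d t' => shape_eqb c d && shape_eqb s' t'
  | _, _ => false
  end.

Lemma shape_eqP : Equality.axiom shape_eqb.
Proof.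
elim=> [|c IHc s IHs] [|d t] /=; try by constructor.
by apply: (iffP andP) => [[/IHc-> /IHs->]|[/IHc ? /IHs ?]].
Qed.

HB.instance Definition _ := hasDecEq.Build rshape shape_eqP.

Definition mk cs := foldr Br Pt cs.
Fixpoint kids t := if t is Br c t' then c :: kids t' else [::].

Lemma mkK : cancel mk kids.
Proof. by elim=> //= c cs ->. Qed.

Lemma kidsK : cancel kids mk.
Proof. by elim=> //= c _ t ->. Qed.

Lemma sgraft_mk cs ds : sgraft (mk cs) (mk ds) = mk (cs ++ ds).
Proof. by elim: cs => //= c cs ->. Qed.

Lemma ssize_gt0 t : 0 < ssize t.
Proof. by elim: t => //= c _ t; rewrite addn_gt0 orbC => ->. Qed.

Lemma reorder_mk cs ds : perm_eq cs ds -> reorder (mk cs) (mk ds).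
Proof.
elim: cs ds => [|c cs IH] ds e; first by move/perm_size: e; case: ds => // _; apply: reorder_refl.
have cds : c \in ds by rewrite -(perm_mem e) mem_head.
apply: (reorder_trans (t2 := mk (c :: rem c ds))).
  apply: reorder_br; first exact: reorder_refl.
  by apply: IH; rewrite -(perm_cons c) (perm_trans e) // perm_to_rem.
elim: ds cds {e IH} => //= d ds IH; rewrite inE eq_sym; case: eqP => [-> _|_ /= /IH r]; first exact: reorder_refl.
apply: (reorder_trans (reorder_swap _ _ _)).
by apply: reorder_br => //; apply: reorder_refl.
Qed.

Lemma Good_perm cs ds : perm_eq cs ds -> Good (mk ds) -> Good (mk cs).
Proof. by rewrite perm_sym => /reorder_mk/Good_reorder. Qed.

Lemma Good_perm1 cs ds K : perm_eq cs ds -> Good (Br (mk ds) K) -> Good (Br (mk cs) K).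
Proof.
rewrite perm_sym => /reorder_mk r; apply: Good_reorder.
by apply: reorder_br r _; apply: reorder_refl.
Qed.

Lemma ssize_perm cs ds : perm_eq cs ds -> ssize (mk cs) = ssize (mk ds).
Proof.
have e cs' : ssize (mk cs') = (\sum_(c <- cs') ssize c).+1.
  by elim: cs' => [|c cs' IH] /=; rewrite ?big_nil // big_cons IH addnS.
by move=> p; rewrite !e (perm_big _ p).
Qed.

Lemma has_front (T : eqType) (p : pred T) s : has p s -> exists x r, p x /\ perm_eq s (x :: r).
Proof. by case/hasP=> x xs px; exists x, (rem x s); split=> //; apply: perm_to_rem. Qed.

(** * Stars, small branches and the pieces that can be split off *)

Definition star m := mk (nseq m Pt).
Definition path2 := star 1.
Definition path3 := Br path2 Pt.
(** The path on five vertices rooted at its middle, which is the bad position. *)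
Definition mid5 := mk [:: path2; path2].

Definition leafy t := all (pred1 Pt) (kids t).
(** The two ways to root a star: at its centre, or at a leaf whose single branch is then rooted at
    the centre. *)
Definition starlike t := leafy t || (if kids t is [:: c] then leafy c else false).
Definition ok t := ~~ starlike t && (t != mid5).

Lemma all_Pt cs : ~~ has (predC1 Pt) cs -> cs = nseq (size cs) Pt.
Proof. by rewrite has_predC negbK => /all_pred1P. Qed.

Lemma leafy_star t : leafy t -> t = star (size (kids t)).
Proof. by move/all_pred1P=> e; rewrite -[LHS]kidsK e size_nseq. Qed.

Lemma starlikeP t : starlike t -> (exists m, t = star m) \/ (exists m, t = Br (star m) Pt).
Proof.
case/orP=> [/leafy_star ->|]; first by left; eexists.
case: t => //= c [|//] /leafy_star ->; right; by eexists.
Qed.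

(** Each conjunct is invariant under reordering the branches; [perm_eq] can replace equality because
    the two branches of [mid5] coincide. *)
Lemma okE cs : ok (mk cs) =
  [&& has (predC1 Pt) cs, (size cs == 1) ==> has (predC leafy) cs & ~~ perm_eq cs [:: path2; path2]].
Proof.
have -> : perm_eq cs [:: path2; path2] = (mk cs == mid5).
  apply/idP/eqP=> [e|/(can_inj mkK)->//].
  by have := perm_all (pred1 path2) e; rewrite /= => /all_pred1P->; rewrite (perm_size e).
rewrite /ok /starlike /leafy mkK negb_or -andbA -(has_predC (pred1 Pt)); congr (_ && _).
by congr (_ && _); case: cs => [|c [|d cs]] //=; rewrite orbF.
Qed.

(** A branch of [zs] other than [Pt] puts a vertex at depth 3, whereas starlike shapes and [mid5]
    have depth at most 2. *)
Lemma ok_Br zs K : K \in [:: Pt; path2; path3] -> has (predC1 Pt) zs -> ok (Br (mk zs) K).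
Proof.
move=> KK; case: zs => // z zs h.
have -> : Br (mk (z :: zs)) K = mk (mk (z :: zs) :: kids K) by rewrite /= kidsK.
rewrite okE; apply/and3P; split=> //.
  by move: KK; rewrite !inE => /or3P[]/eqP-> //=; rewrite orbF -[Br z _]/(mk (z :: zs)) /leafy mkK -has_predC.
move: KK; rewrite !inE => /or3P[]/eqP->; apply/negP=> e.
- by have := perm_size e.
- by have := perm_mem e Pt.
- have /= := perm_mem e (mk (z :: zs)); rewrite !inE eqxx orbb /= => /esym/eqP[ez ezs].
  by move: h; rewrite ez -(mkK zs) ezs.
Qed.

Definition small := [:: Pt; path2; path3].

Lemma Ext2_pair a b : a \in small -> b \in small -> Ext 2 (mk [:: a; b]).
Proof. by rewrite !inE => /or3P[]/eqP-> /or3P[]/eqP->; apply: Ext_found; vm_compute. Qed.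

(** The branch [mid5] is neither starlike nor covered by the induction, so it is split off by a
    placement of its own. *)
Lemma Ext2_mid5 : Ext 2 (mk [:: mid5]).
Proof. by apply: Ext_found; vm_compute. Qed.

Lemma Ext4_star2 : Ext 4 (star 2).
Proof. by apply: Ext_found; vm_compute. Qed.

Lemma Ext4_star3 : Ext 4 (star 3).
Proof. by apply: Ext_found; vm_compute. Qed.

Ltac good_by_search := apply/Good4_Good/Good4_found; vm_compute; reflexivity.
Ltac perm_by_count := apply/seq.permP=> ?; rewrite /= ?count_cat /=; clear; lia.

Lemma Good_hang ws cs : Ext 2 (mk ws) -> Good (mk cs) -> Good (mk (ws ++ cs)).
Proof.
move=> ext_ws /Good_PGood0/(PGood_graft (W := mk ws)).
by rewrite sgraft_mk => h; exact: PGood_Good (h isT ext_ws).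
Qed.

Lemma Good_hang1 ws zs K : Ext 2 (mk ws) -> Good (Br (mk zs) K) -> Good (Br (mk (ws ++ zs)) K).
Proof.
move=> ext_ws /Good_PGood1/(PGood_graft (W := mk ws)).
by rewrite sgraft_mk => h; exact: (PGood_Good (h isT ext_ws)).
Qed.

(** Leaves are attached two or three at a time, and every [m] other than 1 is a sum of twos and
    threes. *)
Lemma PGood_star Ks j m : m != 1 -> PGood 4 Ks (star j) -> PGood 4 Ks (star (m + j)).
Proof.
elim/ltn_ind: m => -[|[|[|[|m]]]] IH // _ g.
- exact: PGood_graft Ext4_star2 g.
- exact: PGood_graft Ext4_star3 g.
- by apply: (PGood_graft (W := star 2) _ Ext4_star2) => //; apply: (IH m.+2).
Qed.

(** Once the [m] leaves are removed their centre has degree at most 1, so it moves by at most 4 and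
    the leaves can be put back. *)
Lemma Good_star Ks m : 1 < m -> Good (sfill Ks Pt) -> Good (sfill Ks (star m)).
Proof.
move=> m1 /Good_PGood4/(PGood_star (j := 0) (m := m)).
by rewrite addn0 => h; apply: PGood_Good (h _); rewrite neq_ltn m1 orbT.
Qed.

Definition big_star t := leafy t && (1 < size (kids t)).
(** A star with at least three leaves, hung by one of them. *)
Definition big_broom t := if kids t is [:: c] then big_star c else false.

Lemma big_starP t : big_star t -> exists2 m, 1 < m & t = star m.
Proof. by case/andP=> /leafy_star e h; exists (size (kids t)). Qed.

Lemma big_broomP t : big_broom t -> exists2 m, 1 < m & t = Br (star m) Pt.
Proof.
rewrite /big_broom -{2}[t]kidsK; case: (kids t) => [|c [|//]] // /big_starP[m m1 ->].
by exists m.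
Qed.

Lemma smallP t : starlike t -> ~~ big_star t -> ~~ big_broom t -> t \in small.
Proof.
case/starlikeP=> [[m ->]|[m ->]]; rewrite /big_star /big_broom /leafy /star.
  by rewrite mkK size_nseq all_nseq /= orbT; case: m => [|[|m]].
by rewrite /= /big_star /leafy mkK size_nseq all_nseq /= orbT; case: m => [|[|m]].
Qed.

Lemma ssize_star m : ssize (star m) = m.+1.
Proof. by elim: m => //= m; rewrite /star /= => ->. Qed.

(** Removing all leaves of the star may give a star or [mid5], so [Good_star] does not suffice. One
    leaf is kept instead, and the search moves every vertex by at most 4; adding two or more leaves
    reaches every [m >= 3], and [m = 2] is searched directly. *)
Lemma Good_double_star K m k : K \in small -> 1 < m -> k <= 1 ->
  Good (Br (Br (star m) (mk (nseq k Pt))) K).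
Proof.
move=> KK; case: m => [|[|[|m]]] // _ k1.
  by case: k k1 => [|[|//]] _; move: KK; rewrite !inE => /or3P[]/eqP->; good_by_search.
have h: PGood 4 [:: K; mk (nseq k Pt)] (star 1).
  apply/Good4_PGood/Good4_found.
  by case: k k1 => [|[|//]] _; move: KK; rewrite !inE => /or3P[]/eqP->; vm_compute.
by have := PGood_Good (@PGood_star _ 1 m.+2 isT h); rewrite addn1.
Qed.

(** * The induction step, by cases on the branches at the root and at its child *)

Section Step.
Variable n : nat.
Hypothesis IH : forall t, ssize t < n -> ok t -> Good t.

Lemma Ext2_branch z : ~~ starlike z -> ssize z < n -> Ext 2 (mk [:: z]).
Proof.
move=> ns lt; have [->|nz] := eqVneq z mid5; first exact: Ext2_mid5.
by apply/Ext_Good/IH; rewrite // /ok ns.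
Qed.

(** The child [y] of the root carries the branches [zs], and [K] is the root with nothing, a leaf or
    a two-vertex path besides. Branches at [y] that are not starlike are cut off where possible,
    large brooms and stars lose their leaves, and small branches go in pairs. *)
Lemma Good_branching zs K : K \in small -> has (predC1 Pt) zs ->
  ssize (Br (mk zs) K) <= n -> Good (Br (mk zs) K).
Proof.
move=> KK hz; rewrite [ssize _]/=.
have [/has_front[z [r [nz e]]]|all_star] := boolP (has (predC starlike) zs).
  rewrite (ssize_perm e) /= in nz * => le; apply: (Good_perm1 e).
  have zn : ssize z < n by have := ssize_gt0 (mk r); have := ssize_gt0 K; lia.
  have zPt : z != Pt by apply: contraNneq nz => ->.
  have [hr|/all_Pt er] := boolP (has (predC1 Pt) r).
    apply: (@Good_hang1 [:: z]); first exact: Ext2_branch.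
    by apply: IH; [have := ssize_gt0 z; rewrite /=; lia|exact: ok_Br].
  (* Besides [z] only leaves hang at [y], so cutting [z] off may leave a star or [mid5]; when there
     are at most one such leaf, [Good_ins] handles most cases with [z] good. *)
  have gz : z = mid5 \/ Good z.
    by have [|h] := eqVneq z mid5; [left | right; apply: IH; rewrite // /ok nz].
  move: (size r) er le => [|[|k]] -> /= le.
  - case: gz => [->|gz]; move: KK; rewrite !inE => /or3P[]/eqP KE.
    1-3: rewrite KE; good_by_search.
    (* For [K = path3] the rest is a path on four vertices rooted at an inner vertex, and cutting
       [z] off works. *)
    3: by rewrite KE; apply: (@Good_hang1 [:: z] [::]); [exact: Ext2_branch|good_by_search].
    1-2: by apply: Good_ins gz; rewrite KE; apply: Ins_found; vm_compute.
  - case: gz => [->|gz]; move: KK; rewrite !inE => /or3P[]/eqP->.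
    1-3: good_by_search.
    1-3: by apply: (Good_ins _ gz); apply: Ins_found; vm_compute.
  - apply: (@Good_perm1 [:: z, Pt, Pt & nseq k Pt] [:: Pt, Pt, z & nseq k Pt]); first by perm_by_count.
    apply: (@Good_hang1 [:: Pt; Pt]); first exact: Ext2_pair.
    by apply: IH; [rewrite /=; lia|apply: ok_Br; rewrite //= zPt].
have star_of z : z \in zs -> starlike z by move=> h; move/hasPn: all_star => /(_ z h)/negPn.
have [/has_front[z [r [/big_broomP[m m1 ->] e]]]|no_broom] := boolP (has big_broom zs).
  rewrite (ssize_perm e) => /= le; apply: (Good_perm1 e).
  (* The final [Pt] is the leaf by which the broom hangs; without the other leaves the broom becomes
     [path2]. *)
  apply: (@Good_star [:: K; mk r; Pt]) => //=; apply: IH; last exact: (@ok_Br (path2 :: r)).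
  by rewrite ssize_star in le; rewrite /=; lia.
have [/has_front[z [r [/big_starP[m m1 ->] e]]]|no_star] := boolP (has big_star zs).
  rewrite (ssize_perm e) => /= le; apply: (Good_perm1 e).
  have [hr|/all_Pt er] := boolP (has (predC1 Pt) r).
    apply: (@Good_star [:: K; mk r]) => //=; apply: IH; last exact: (@ok_Br (Pt :: r)).
    by rewrite ssize_star in le; rewrite /=; lia.
  move: (size r) er le => [|[|k]] -> /= le.
  - exact: (@Good_double_star _ _ 0).
  - exact: (@Good_double_star _ _ 1).
  - apply: (@Good_perm1 [:: star m, Pt, Pt & nseq k Pt] [:: Pt, Pt, star m & nseq k Pt]); first by perm_by_count.
    apply: (@Good_hang1 [:: Pt; Pt]); first exact: Ext2_pair.
    by apply: IH; [rewrite /=; lia|apply: ok_Br => //=; case: (m) m1 => [|[]]].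
have zs_small z : z \in zs -> z \in small.
  by move=> zzs; apply: smallP; [exact: star_of|exact: (hasPn no_star)|exact: (hasPn no_broom)].
case/has_front: hz => N [r [NPt e]].
have {star_of no_star no_broom all_star} rs z : z \in N :: r -> z \in small by rewrite -(perm_mem e); apply: zs_small.
rewrite (ssize_perm e) => /= le; apply: (Good_perm1 e).
have Ns : N \in [:: path2; path3].
  by move: NPt (rs N (mem_head _ _)); rewrite /= !inE => /negbTE->.
(* Keeping the branch [N] ensures that the tree stays [ok] after two others are split off. *)
case: r e rs le => [|a [|b r]] e rs /= le.
- by move: KK Ns; rewrite !inE => /or3P[]/eqP-> /orP[]/eqP->; good_by_search.
- have := rs a; rewrite !inE eqxx orbT => /(_ isT) aS.
  move: KK Ns aS; rewrite !inE => /or3P[]/eqP-> /orP[]/eqP-> /or3P[]/eqP->; good_by_search.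
- apply: (@Good_perm1 [:: N, a, b & r] [:: a, b, N & r]); first by perm_by_count.
  apply: (@Good_hang1 [:: a; b]); first by apply: Ext2_pair; apply: rs; rewrite !inE eqxx ?orbT.
  apply: IH; last by apply: ok_Br => //=; move: NPt => /= ->.
  by have := ssize_gt0 a; rewrite /=; lia.
Qed.

Lemma Good_stars K k : K \in small -> ok (Br (star k) K) -> ssize (Br (star k) K) <= n ->
  Good (Br (star k) K).
Proof.
have step j K' : ok (Br (star j) K') -> ssize (Br (star j.+2) K') <= n -> Good (Br (star j.+2) K').
  move=> okj le; apply: (@Good_hang1 [:: Pt; Pt] (nseq j Pt)); first exact: Ext2_pair.
  by apply: IH okj; move: le; rewrite /= !ssize_star; lia.
rewrite !inE => /or3P[]/eqP->.
- by rewrite /ok /starlike /leafy [kids (Br _ _)]/= /star mkK all_nseq !orbT.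
- case: k => [|[|[|k]]] // _ le; [good_by_search|good_by_search|apply: (step k.+1) le].
  rewrite (@okE [:: star k.+1; Pt]); apply/and3P; split=> //.
  by apply/negP=> p; have := perm_mem p Pt.
(* The value [k = 1] is [mid5], excluded by [ok]; hence [k = 3] cannot be reduced by two and is
   searched. *)
- case: k => [|[|[|[|k]]]] // _ le; [good_by_search|good_by_search|good_by_search|].
  apply: (step k.+2) le; rewrite (@okE [:: star k.+2; path2]); apply/and3P; split=> //.
  by apply/negP=> p; have := perm_mem p (star k.+2); rewrite mem_head.
Qed.

Lemma Good_Br Y K : K \in small -> ok (Br Y K) -> ssize (Br Y K) <= n -> Good (Br Y K).
Proof.
move=> KK; have [h|/all_Pt e] := boolP (has (predC1 Pt) (kids Y)).
  by move=> _; rewrite -{1 2}(kidsK Y); apply: Good_branching.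
by rewrite -(kidsK Y) e; apply: Good_stars.
Qed.

Lemma ok_perm cs ds : perm_eq cs ds -> ok (mk cs) = ok (mk ds).
Proof.
move=> e; rewrite !okE (perm_size e) !(perm_has _ e); congr [&& _, _ & ~~ _].
exact: permPl.
Qed.

(** Together with the root, a second branch [Pt] or [path2] forms [path2] or [path3], which is again
    small, so [Good_Br] applies. *)
Lemma Good_pair cs Y K : K \in [:: Pt; path2] -> perm_eq cs [:: Y; K] -> ok (mk cs) ->
  ssize (mk cs) <= n -> Good (mk cs).
Proof.
move=> KK e; rewrite (ok_perm e) (ssize_perm e) => okY le.
apply: (Good_perm e); apply: Good_Br => //=.
by move: KK; rewrite !inE => /orP[]/eqP->.
Qed.

Lemma Good_step cs : ok (mk cs) -> ssize (mk cs) <= n -> Good (mk cs).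
Proof.
move=> okcs le; have := okcs; rewrite okE => /and3P[hcs one_cs no_mid5].
have [sz1|sz2] : size cs = 1 \/ 1 < size cs by case: (cs) hcs => [|c [|d cs']] // _; [left|right].
  by case: cs sz1 {hcs one_cs no_mid5} okcs le => [|c [|//]] // _; apply: Good_Br.
have tl z r : perm_eq cs (z :: r) -> 0 < size r by move/perm_size => e; move: sz2; rewrite e.
have [/has_front[z [r [nz e]]]|all_star] := boolP (has (predC starlike) cs).
  have := le; rewrite (ssize_perm e) /= in nz * => le'; have r0 := tl _ _ e.
  have zn : ssize z < n by have := ssize_gt0 (mk r); lia.
  have rn : ssize (mk r) < n by have := ssize_gt0 z; lia.
  have zPt : z != Pt by apply: contraNneq nz => ->.
  have zp2 : z != path2 by apply: contraNneq nz => ->.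
  have zl : ~~ leafy z by apply: contraNN nz => h; rewrite /starlike h.
  have ext_z := Ext2_branch nz zn.
  have ok_z k : ok (mk (z :: nseq k Pt)).
    rewrite okE /= zPt zl implybT /=; apply/negP=> p; have := perm_mem p z.
    by rewrite mem_head !inE (negbTE zp2).
  have [okr|] := boolP (ok (mk r)).
    by apply: (Good_perm e); apply: (@Good_hang [:: z]) => //; apply: IH.
  (* The rest at the root is a star rooted at its centre, a star rooted at a leaf, or [mid5]; in
     each case pieces of the rest are removed and [z] is kept, or [Good_pair] applies. *)
  rewrite negb_and negbK => /orP[/starlikeP[[m er]|[m er]]|/negPn/eqP er].
  - have {}er: r = nseq m Pt by apply: (can_inj mkK).
    case: m er e le' => [er|[er|m er]] e le'; first by move: r0; rewrite er.
      by rewrite er in e; apply: (Good_pair (K := Pt) _ e).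
    apply: (@Good_perm _ [:: Pt, Pt, z & nseq m Pt]); first by apply: (perm_trans e); rewrite er; perm_by_count.
    apply: (@Good_hang [:: Pt; Pt] (z :: _)); first exact: Ext2_pair.
    by apply: IH (ok_z m); move: le'; rewrite er /=; lia.
  - have {}er: r = [:: star m] by apply: (can_inj mkK).
    case: m er e le' => [er|[er|m er]] e le'.
    + by rewrite er in e; apply: (Good_pair (K := Pt) _ e).
    + by rewrite er in e; apply: (Good_pair (K := path2) _ e).
    apply: (@Good_perm _ [:: star m.+2; z]); first by apply: (perm_trans e); rewrite er; perm_by_count.
    apply: (@Good_star [:: mk [:: z]] m.+2) => //; apply: IH.
      by move: le'; rewrite er /= ; have := ssize_gt0 (star m); lia.
    by rewrite (@ok_perm [:: Pt; z] [:: z; Pt]) ?(ok_z 1) //; perm_by_count.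
  - have {}er: r = [:: path2; path2] by apply: (can_inj mkK).
    apply: (@Good_perm _ [:: path2; path2; z]); first by apply: (perm_trans e); rewrite er; perm_by_count.
    apply: (@Good_hang [:: path2; path2] [:: z]); first exact: Ext2_pair.
    by apply: IH (ok_z 0); move: le'; rewrite er /=; lia.
have star_of z : z \in cs -> starlike z by move=> h; move/hasPn: all_star => /(_ z h)/negPn.
have [/has_front[z [r [/big_broomP[m m1 ->] e]]]|no_broom] := boolP (has big_broom cs).
  (* Reducing the broom to [path2] produces [mid5] exactly when the rest is a single [path2]. *)
  have r0 := tl _ _ e; have [re|rp] := eqVneq r [:: path2].
    by rewrite re in e; apply: (Good_pair (K := path2) _ e).
  have := le; rewrite (ssize_perm e) /= => le'; apply: (Good_perm e).
  apply: (@Good_star [:: mk r; Pt]) => //=; apply: IH; first by rewrite ssize_star in le'; rewrite /=; lia.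
  rewrite (@okE (path2 :: r)); apply/and3P; split=> //; first by rewrite /= eqSS eqn0Ngt r0.
  by rewrite perm_cons; apply: contraNN rp => /perm_small_eq->.
have [/has_front[z [r [/big_starP[m m1 ->] e]]]|no_star] := boolP (has big_star cs).
  have r0 := tl _ _ e; have := le; rewrite (ssize_perm e) /= ssize_star => le'.
  have [hr|/all_Pt er] := boolP (has (predC1 Pt) r).
    apply: (Good_perm e); apply: (@Good_star [:: mk r]) => //=; apply: IH; first by rewrite /=; lia.
    by rewrite (@okE (Pt :: r)); apply/and3P; split=> //; rewrite /= eqSS eqn0Ngt r0.
  move: (size r) er e le' => [|[|[|k]]] er e le'; first by move: r0; rewrite er.
  + by rewrite er in e; apply: (Good_pair (K := Pt) _ e).
  (* Splitting off the two leaves at the root, or all leaves of the star, would give a star. Two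
     leaves of the star are removed instead, which works from [m = 3] on. *)
  + apply: (Good_perm e); rewrite er; case: m m1 le' {e} => [|[|[|m]]] // _ le'.
      by good_by_search.
    apply: (@Good_hang1 [:: Pt; Pt] (nseq m.+1 Pt)); first exact: Ext2_pair.
    apply: IH; first by move: le'; rewrite er -/(star m.+1) [_ (Br _ _)]/= ssize_star /=; lia.
    rewrite (@okE [:: star m.+1; Pt; Pt]); apply/and3P; split=> //.
    by apply/negP=> /perm_size.
  + apply: (@Good_perm _ [:: Pt, Pt, star m & nseq k.+1 Pt]).
      by apply: (perm_trans e); rewrite er; perm_by_count.
    apply: (@Good_hang [:: Pt; Pt] (star m :: nseq k.+1 Pt)); first exact: Ext2_pair.
    apply: IH; first by move: le'; rewrite er /= ssize_star; lia.
    rewrite (@okE (star m :: nseq k.+1 Pt)); apply/and3P; split=> //; first by case: (m) m1.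
    by apply/negP=> p; have := perm_mem p Pt; rewrite !inE orbT.
have cs_small z : z \in cs -> z \in small.
  by move=> zzs; apply: smallP; [exact: star_of|exact: (hasPn no_star)|exact: (hasPn no_broom)].
have [p3|no_p3] := boolP (path3 \in cs).
  have e := perm_to_rem p3; move: (rem _ _) e => r e; have r0 := tl _ _ e.
  have rs z : z \in r -> z \in small by move=> zr; apply: cs_small; rewrite (perm_mem e) inE zr orbT.
  case: r r0 e rs => [|a [|b r]] // _ e rs.
    have [a3|na3] := eqVneq a path3; first by rewrite a3 in e; apply: (Good_perm e); good_by_search.
    apply: (Good_pair (K := a) _ e) => //.
    by have := rs a (mem_head _ _); rewrite !inE (negbTE na3) orbF.
  apply: (@Good_perm _ [:: a, b, path3 & r]); first by apply: (perm_trans e); perm_by_count.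
  apply: (@Good_hang [:: a; b] (path3 :: r)).
    by apply: Ext2_pair; apply: rs; rewrite !inE eqxx ?orbT.
  apply: IH.
    by have := le; rewrite (ssize_perm e) /=; have := ssize_gt0 a; lia.
  by rewrite okE; apply/and3P; split=> //; rewrite /= implybT.
have {}cs_small z : z \in cs -> z \in [:: Pt; path2].
  move=> zzs; have := cs_small z zzs; rewrite !inE.
  by have -> : z == path3 = false; [apply: contraNF no_p3 => /eqP<- | rewrite orbF].
case/has_front: hcs => N [r [NPt e]].
have rs z : z \in N :: r -> z \in [:: Pt; path2] by rewrite -(perm_mem e); apply: cs_small.
have EN : N = path2 by move: NPt (rs N (mem_head _ _)); rewrite /= !inE => /negbTE-> /eqP.
rewrite {N NPt}EN in e rs; have := tl _ _ e.
(* With at least five branches, splitting off two keeps three or more, which rules out [mid5];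
   shorter lists go to [Good_pair] or to the search. *)
case: r e rs => [|a [|b [|c [|d r]]]] // e rs _.
- have aS : a \in [:: Pt; path2] by apply: rs; rewrite !inE eqxx orbT.
  exact: (Good_pair aS e).
- have := rs a; have := rs b; rewrite !inE !eqxx !orbT => /(_ isT)/orP[]/eqP EB /(_ isT)/orP[]/eqP EA.
  1-4: by rewrite EA EB in e; apply: (Good_perm e); good_by_search.
- have := rs a; have := rs b; have := rs c; rewrite !inE !eqxx !orbT.
  move=> /(_ isT)/orP[]/eqP EC /(_ isT)/orP[]/eqP EB /(_ isT)/orP[]/eqP EA.
  1-8: by rewrite EA EB EC in e; apply: (Good_perm e); good_by_search.
- apply: (@Good_perm _ [:: c, d, path2, a, b & r]); first by apply: (perm_trans e); perm_by_count.
  apply: (@Good_hang [:: c; d] [:: path2, a, b & r]).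
    by apply: Ext2_pair; have := rs c; have := rs d; rewrite !inE !eqxx !orbT => /(_ isT) h1 /(_ isT) h2;
       rewrite orbA ?h1 ?h2.
  apply: IH; last by rewrite okE; apply/and3P; split=> //; apply/negP=> /perm_size.
  by have := le; rewrite (ssize_perm e) /=; have := ssize_gt0 c; lia.
Qed.

End Step.

Theorem Good_ok t : ok t -> Good t.
Proof.
move: {2}(ssize t) (leqnn (ssize t)) => n; elim: n t => [|n IH] t.
  by rewrite leqNgt ssize_gt0.
rewrite -{1 2 3}(kidsK t) => le okt; apply: (Good_step (n := n.+1)) => //.
Qed.

(** * From graphs to rooted trees *)

Section Shapes.
Variable T : eqType.
Implicit Type t : tree T.

Lemma leafy_edges t : leafy (shape_of t) -> {in edges t, forall p, p.1 = root t}.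
Proof.
rewrite /leafy; elim: t => //= -[x|//] _ t IH /= /IH{}IH p.
by rewrite inE => /predU1P[->|/IH].
Qed.

Lemma starlike_edges t : starlike (shape_of t) ->
  exists c, {in edges t, forall p, p.1 = c \/ p.2 = c}.
Proof.
case/orP=> [/leafy_edges h|]; first by exists (root t) => p /h; left.
case: t => //= c [y|//] /= /leafy_edges h; exists (root c) => p.
by rewrite inE cats0 => /predU1P[->|/h]; [right|left].
Qed.

Lemma mid5_edges t : uniq (verts t) -> shape_of t = mid5 ->
  exists f : 'I_5 -> T, [/\ injective f, root t = f (inord 2)
    & forall i j, adj (edges t) (f i) (f j) = (i == j.+1 :> nat) || (j == i.+1 :> nat)].
Proof.
case: t => //= -[//|[a|//] [b|//]] [//|[//|[c|//] [d|//]] [y|//]] //= u _.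
(* [V] runs along the path with the root [y] at position 2, and [E0] lists its edges in the order
   and orientation that [edges] produces. *)
pose V := [:: a; b; y; d; c]; pose E0 := [:: (2, 1); (1, 0); (2, 3); (3, 4)].
have uV : uniq V by rewrite (perm_uniq (_ : perm_eq _ [:: a; b; c; d; y])) //; perm_by_count.
have inj : {in iota 0 5 &, injective (nth y V)}.
  by move=> i j; rewrite !mem_iota !add0n => /= lti ltj /eqP; rewrite nth_uniq // => /eqP.
have cl : closed_edges (iota 0 5) E0 by move=> p; rewrite !inE => /or4P[]/eqP->.
exists (fun i : 'I_5 => nth y V i); split.
- by move=> i j /inj h; apply/val_inj/h; rewrite mem_iota /=.
- by rewrite inordK.
move=> i j; rewrite (adj_map inj cl) ?mem_iota ?ltn_ord //.
by case: i j => [[|[|[|[|[|]]]]]] // ? [[|[|[|[|[|]]]]]].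
Qed.

Lemma hang_leaf t a b : a \in verts t -> exists t',
  [/\ root t' = root t, perm_eq (verts t') (b :: verts t) & perm_eq (edges t') ((a, b) :: edges t)].
Proof.
elim: t => [y|c IHc t IHt] /=.
  by rewrite inE => /eqP->; exists (Add (One b) (One y)).
rewrite mem_cat => /orP[/IHc[c' [r v e]]|/IHt[t' [r v e]]].
  exists (Add c' t); split=> //=; first by rewrite -cat_cons perm_cat2r.
  move/seq.permP: e => e; apply/seq.permP=> q; have := e q.
  by rewrite r /= !count_cat; clear; lia.
exists (Add c t'); split=> //=.
  by move/seq.permP: v => v; apply/seq.permP=> q; have := v q; rewrite /= !count_cat /=; clear; lia.
move/seq.permP: e => e; apply/seq.permP=> q; have := e q.
by rewrite r /= !count_cat /=; clear; lia.
Qed.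

Lemma size_edges t : size (verts t) = (size (edges t)).+1.
Proof. by elim: t => //= c IHc t IHt; rewrite !size_cat IHc IHt; lia. Qed.

(** Both orientations of every edge, to be compared with [num_edges], which halves a number of
    ordered pairs. *)
Definition arcs t := edges t ++ [seq (p.2, p.1) | p <- edges t].

Lemma arcsE t a b : ((a, b) \in arcs t) = adj (edges t) a b.
Proof.
rewrite mem_cat /adj; congr (_ || _); apply/mapP/idP => [[[p q] h [-> ->]]//|h].
by exists (b, a).
Qed.

Lemma arcs_uniq t : uniq (verts t) -> uniq (arcs t).
Proof.
elim: t => // c IHc t IHt; rewrite [verts _]/= cat_uniq => /and3P[/IHc uc /hasPn disj /IHt ut].
have -> : uniq (arcs (Add c t)) =
    uniq [:: (root t, root c), (root c, root t) & arcs c ++ arcs t].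
  apply: perm_uniq; apply/seq.permP=> q.
  by rewrite /arcs /= !count_cat /= !map_cat !count_cat; clear; lia.
have dis v : v \in verts c -> v \in verts t -> False by move=> vc /disj; rewrite vc.
have nrc : root t != root c.
  by apply/eqP=> e; apply: (dis (root c)); rewrite ?root_verts // -e root_verts.
have out t' a b : (a, b) \in arcs t' -> a \in verts t' /\ b \in verts t'.
  by rewrite arcsE => /(closed_adj (@edges_closed _ t')).
rewrite /= inE !(mem_cat _ (arcs c)) !negb_or xpair_eqE (negbTE nrc) /= cat_uniq uc ut /= andbT.
apply/and3P; split.
- apply/andP; split; apply/negP=> /out[h1 h2].
    by apply: dis h1 (root_verts t).
  by apply: dis (root_verts c) h2.
- apply/andP; split; apply/negP=> /out[h1 h2].
    by apply: dis h2 (root_verts t).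
  by apply: dis (root_verts c) h1.
- by apply/hasPn=> -[a b] /out[at_ _]; apply/negP=> /out[ac _]; apply: dis ac at_.
Qed.

End Shapes.

Lemma near_dist (T : finType) (e : rel T) E k a b :
  (forall u v, adj E u v -> e u v) -> near E k a b -> dist_le e a b k.
Proof.
move=> h; elim: k b => [|k IH] b; first by rewrite nearO => /eqP->; exists [::].
case/nearS=> [/IH[p [sp pp lp]]|[c /IH[p [sp pp lp]] /h cb]].
  by exists p; split=> //; apply: leqW.
by exists (rcons p b); rewrite size_rcons rcons_path last_rcons pp lp.
Qed.

Lemma crossing_edge (T : finType) (e : rel T) (A : pred T) x y :
  connect e x y -> A x -> ~~ A y -> exists a b, [/\ A a, ~~ A b & e a b].
Proof.
case/connectP=> p; elim: p x => [|z p IH] x /=; first by move=> _ -> ->.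
case/andP=> xz pz ey Ax nAy; have [Az|nAz] := boolP (A z); first exact: (IH z).
by exists x, z.
Qed.

(** A tree grows from [x]: while it misses a vertex, connectedness gives an edge of [e] leaving it,
    whose far end is hung as a new leaf. *)
Lemma spanning_tree (T : finType) (e : rel T) x : (forall a b, connect e a b) ->
  exists t : tree T, [/\ root t = x, uniq (verts t), (forall v, v \in verts t)
    & {in edges t, forall p, e p.1 p.2}].
Proof.
move=> con.
suff grow n (t : tree T) : #|T| - size (verts t) <= n -> root t = x -> uniq (verts t) ->
    {in edges t, forall p, e p.1 p.2} ->
    exists t : tree T, [/\ root t = x, uniq (verts t), (forall v, v \in verts t)
      & {in edges t, forall p, e p.1 p.2}].
  exact: (grow #|T| (One x)) (leq_subr _ _) _ _ _.
elim: n t => [|n IH] t le r u et.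
  exists t; split=> // v; move: le; rewrite leqn0 subn_eq0 cardE => le.
  have [_ ->] := uniq_min_size u (fun w _ => mem_enum T w) le.
  by rewrite mem_enum.
have [/forallP all|] := boolP [forall v, v \in verts t]; first by exists t.
rewrite negb_forall => /existsP[v nv].
have xt : x \in verts t by rewrite -r root_verts.
have [a [b [at_ nb ab]]] := crossing_edge (con x v) xt nv.
have [t' [r' v' e']] := hang_leaf b at_.
apply: (IH t'); rewrite ?r' // ?(perm_size v') ?(perm_uniq v') /= ?nb //.
  by rewrite subnS -subn1 leq_subLR.
by move=> p; rewrite (perm_mem e') inE => /predU1P[->|/et].
Qed.

Lemma card_verts (T : finType) (t : tree T) : uniq (verts t) -> (forall v, v \in verts t) ->
  #|T| = size (verts t).
Proof.
move=> u all; rewrite cardE; apply/perm_size/uniq_perm; rewrite ?enum_uniq // => v.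
by rewrite all mem_enum.
Qed.

(* A symmetric pair of arcs of [e] missing from the spanning tree would make too many edges. *)
Lemma tree_edges (T : finType) (e : rel T) (t : tree T) : is_tree e -> uniq (verts t) ->
  (forall v, v \in verts t) -> {in edges t, forall p, e p.1 p.2} -> e =2 adj (edges t).
Proof.
case=> -[irr sym] n0 _ ne u all et a b.
have eD c d : adj (edges t) c d -> e c d.
  by case/orP=> /et //=; rewrite sym.
have sT := etrans (card_verts u all) (size_edges t).
apply/idP/idP; last exact: eD.
move=> ab; apply/negPn/negP => nab.
have uab : uniq ((a, b) :: (b, a) :: arcs t).
  rewrite /= inE negb_or !arcsE nab adjC nab arcs_uniq // !andbT xpair_eqE negb_and.
  by apply/orP; left; apply: contraTneq ab => ->; rewrite irr.
have sub : {subset (a, b) :: (b, a) :: arcs t <= enum [set p : T * T | e p.1 p.2]}.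
  move=> [c d]; rewrite mem_enum !inE arcsE /= => /or3P[/eqP[-> ->]|/eqP[-> ->]|/eD] //.
  by rewrite sym.
have := uniq_leq_size uab sub; rewrite -cardE /= size_cat size_map.
move: ne; rewrite /num_edges sT subn1 /=; move: #|_| (size _) => N m; clear; lia.
Qed.

(** This bound turns [degree e y = 1] into the premise [deg <= 1] of the leaf condition. Each edge
    at [y] yields an arc out of [y], and distinct arcs out of [y] have distinct ends. *)
Lemma deg_degree (T : finType) (e : rel T) (t : tree T) y : uniq (verts t) ->
  e =2 adj (edges t) -> deg (edges t) y <= degree e y.
Proof.
move=> u eE; pose N := [seq p.2 | p <- arcs t & p.1 == y].
have uN : uniq N.
  rewrite map_inj_in_uniq ?filter_uniq ?arcs_uniq // => -[a b] [c d].
  by rewrite !mem_filter /= => /andP[/eqP-> _] /andP[/eqP-> _] ->.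
have : size N <= degree e y.
  rewrite /degree cardE; apply: uniq_leq_size => // z /mapP[[a b]].
  rewrite mem_filter /= => /andP[/eqP-> h] ->; rewrite mem_enum inE eE.
  by rewrite -arcsE.
apply: leq_trans; rewrite size_map size_filter count_cat count_map /deg.
by rewrite -count_predUI leq_addr.
Qed.

Theorem theorem1p8 (T : finType) (e : rel T) (x : T) :
  is_tree e -> ~ is_star e -> ~ bad_vertex e x ->
  exists s : {perm T}, good_two_placement e x s.
Proof.
move=> tree_e nstar nbad; have [_ _ con _] := tree_e.
have [t [rt u all et]] := spanning_tree x con.
have eE := tree_edges tree_e u all et.
have okt : ok (shape_of t).
  apply/andP; split.
    apply/negP=> /starlike_edges[c h]; apply: nstar; exists c => a b.
    by rewrite eE => /orP[/h[]|/h[]] /= ->; [left|right|right|left].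
  apply/eqP=> t5; have [f [f_inj ft fE]] := mid5_edges u t5; apply: nbad; exists f; split.
  - apply: inj_card_bij => //.
    by rewrite (card_verts u all) size_verts t5 card_ord.
  - by move=> i j; rewrite eE fE.
  - by rewrite -rt.
have [s gs] := Good_ok okt u erefl; rewrite rt in gs.
(* The vertex list enumerates [T] without repetition and [s] permutes it. *)
have inj_s : injective s.
  apply/injectiveP; rewrite /injectiveb /dinjectiveb.
  case/and3P: gs => p _ _; have pV : perm_eq (enum T) (verts t).
    by apply: uniq_perm; rewrite ?enum_uniq // => v; rewrite all mem_enum.
  by rewrite (perm_uniq (perm_map s pV)) (perm_uniq p).
have dist k a b : near (edges t) k a b -> dist_le e a b k.
  by apply: near_dist => c d; rewrite eE.
exists (perm inj_s); split; [split|] => [y|a b|a b||y|y]; rewrite ?permE.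
- by have [] := good_vertex gs (all y).
- by rewrite eE => /(placement_edge gs isT isT)/andP[h _]; rewrite eE.
- by rewrite eE => /(placement_edge gs isT isT)/andP[_ /dist].
- by rewrite eE; have [_ h _ _] := good_vertex gs (all x); apply: h.
- by rewrite eE => h; apply: dist; have [_ _ h' _] := good_vertex gs (all y); apply: h'.
- move=> d1; apply: dist; have [_ _ _ h] := good_vertex gs (all y); apply: h.
  by rewrite -d1 deg_degree.
Qed.
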